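(* Let $I$ be a compact real interval and let $f:I\to I$ be continuous. Suppose $f$ has a periodic orbit of minimal period $s=2^k(2n+1)$, where $n\ge1$ and $k\ge0$ are integers, and has no periodic orbit of minimal period $r$ for any $r$ with $r\prec s$ in the Sharkovskii ordering. Then for every positive integer $t$ with $s\prec t$ in the Sharkovskii ordering and $2^k\mid t$, $f$ has at least $\Phi_n(t/2^k)/(t/2^k)$ distinct periodic orbits of minimal period $t$. Moreover, this lower bound is sharp: it is attained by some such $f$.
   Context: The Sharkovskii ordering of the positive integers is $3\prec5\prec7\prec\cdots\prec2\cdot3\prec2\cdot5\prec\cdots\prec2^2\cdot3\prec2^2\cdot5\prec\cdots\prec\cdots\prec2^3\prec2^2\prec2\prec1$ (odd numbers $>1$ in increasing order, then twice those, then four times those, etc., and finally the powers of $2$ in decreasing order). For an integer-valued $\phi$ on the positive integers, $\Phi(m,\phi)=\sum_{d\mid m}\mu(m/d)\phi(d)$ ($\mu$ the Möbius function). $\Phi_1(m)=\Phi(m,\phi)$ where $\phi$ is the Lucas sequence ($\phi(1)=1,\phi(2)=3,\phi(m+2)=\phi(m+1)+\phi(m)$). For $n>1$: let $Q_n=\{(1,n+1)\}\cup\{(m,2n+2-m):2\le m\le n\}\cup\{(m,2n+1-m):n+1\le m\le 2n\}$; for $1\le i,j\le 2n$, $k\ge1$, let $b_{1,i,j,n}=1$ if $(i,j)\in Q_n$ and $0$ otherwise, and $b_{k+1,i,j,n}=b_{k,i,2n+1-j,n}+b_{k,i,n+1,n}$ ($1\le j\le n-1$), $b_{k+1,i,n,n}=b_{k,i,n,n}+b_{k,i,n+1,n}$,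 $b_{k+1,i,n+1,n}=b_{k,i,1,n}$, $b_{k+1,i,j,n}=b_{k,i,2n+2-j,n}$ ($n+2\le j\le 2n$); let $c_{k,n}=\sum_{i=1}^{2n}b_{k,i,i,n}+b_{k,n+1,n,n}+\sum_{i=n+2}^{2n}b_{k,i,n+1,n}$, and $\Phi_n(m)=\Phi(m,\phi_n)$ with $\phi_n(k)=c_{k,n}$. *)

(* Defs.v *)
From Stdlib Require Import Reals Lra Arith ZArith List Bool.
Import ListNotations.
Open Scope R_scope.
Open Scope bool_scope.

Fixpoint fiter (n : nat) (f : R -> R) (x : R) : R :=
  match n with O => x | S m => f (fiter m f x) end.

Definition continuous_on_interval (f : R -> R) (a b : R) : Prop :=
  forall x, a <= x <= b -> forall eps, 0 < eps ->
    exists delta, 0 < delta /\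
      forall y, a <= y <= b -> Rabs (y - x) < delta -> Rabs (f y - f x) < eps.

Definition maps_into (f : R -> R) (a b : R) : Prop :=
  forall x, a <= x <= b -> a <= f x <= b.

Definition min_period (f : R -> R) (m : nat) (x : R) : Prop :=
  (1 <= m)%nat /\ fiter m f x = x /\
  forall j, (0 < j < m)%nat -> fiter j f x <> x.

Definition has_orbit_of_period (f : R -> R) (a b : R) (m : nat) : Prop :=
  exists x, a <= x <= b /\ min_period f m x.

Definition same_orbit (f : R -> R) (x y : R) : Prop :=
  exists j : nat, fiter j f x = y.

(* L is a list of points of [a,b] of minimal period m lying on pairwise
   distinct orbits; thus L represents length L distinct periodic orbits
   of minimal period m *)
Definition distinct_orbits (f : R -> R) (a b : R) (m : nat) (L : list R) : Prop :=
  (forall x, In x L -> a <= x <= b /\ min_period f m x) /\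
  (forall i j, (i < length L)%nat -> (j < length L)%nat -> i <> j ->
     ~ same_orbit f (nth i L 0) (nth j L 0)).

Definition covers_orbits (f : R -> R) (a b : R) (m : nat) (L : list R) : Prop :=
  forall y, a <= y <= b -> min_period f m y -> exists x, In x L /\ same_orbit f x y.

(* sh_prec x y : x strictly precedes y in the Sharkovskii ordering
   3 < 5 < 7 < ... < 2*3 < 2*5 < ... < 2^2*3 < ... < 2^3 < 2^2 < 2 < 1 *)
Definition sh_prec (x y : nat) : Prop :=
  exists a o c p : nat, Nat.Odd o /\ Nat.Odd p /\
    x = (2 ^ a * o)%nat /\ y = (2 ^ c * p)%nat /\
    (  ((1 < o)%nat /\ (1 < p)%nat /\ ((a < c)%nat \/ (a = c /\ (o < p)%nat)))
    \/ ((1 < o)%nat /\ p = 1%nat)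
    \/ (o = 1%nat /\ p = 1%nat /\ (c < a)%nat)).

Definition divides_b (d m : nat) : bool := Nat.eqb (m mod d) 0.

Definition is_prime_b (p : nat) : bool :=
  Nat.leb 2 p && forallb (fun d => negb (divides_b d p)) (seq 2 (p - 2)).

Definition squarefree_b (m : nat) : bool :=
  forallb (fun d => negb (divides_b (d * d) m)) (seq 2 (m - 1)).

Definition nprimefactors (m : nat) : nat :=
  length (filter (fun p => is_prime_b p && divides_b p m) (seq 2 (m - 1))).

Definition mobius (m : nat) : Z :=
  if squarefree_b m then (if Nat.even (nprimefactors m) then 1%Z else (-1)%Z) else 0%Z.

Definition divisors (m : nat) : list nat := filter (fun d => divides_b d m) (seq 1 m).

Definition sumZ (l : list Z) : Z := fold_right Z.add 0%Z l.

Definition PhiGen (m : nat) (phi : nat -> Z) : Z :=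
  sumZ (map (fun d => (mobius (m / d) * phi d)%Z) (divisors m)).

Fixpoint lucas_aux (m : nat) : Z * Z :=  (* (L(m+1), L(m+2)) *)
  match m with
  | O => (1%Z, 3%Z)
  | S k => let '(u, v) := lucas_aux k in (v, (u + v)%Z)
  end.
Definition lucas (m : nat) : Z := fst (lucas_aux (m - 1)).

Definition inQ (n i j : nat) : bool :=
  (Nat.eqb i 1 && Nat.eqb j (n + 1))
  || (Nat.leb 2 i && Nat.leb i n && Nat.eqb j (2 * n + 2 - i))
  || (Nat.leb (n + 1) i && Nat.leb i (2 * n) && Nat.eqb j (2 * n + 1 - i)).

(* bseq k n i j = b_{k+1,i,j,n} *)
Fixpoint bseq (k n i j : nat) : Z :=
  match k with
  | O => if inQ n i j then 1%Z else 0%Z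
  | S k' =>
      if Nat.leb 1 j && Nat.leb j (n - 1) then
        (bseq k' n i (2 * n + 1 - j) + bseq k' n i (n + 1))%Z
      else if Nat.eqb j n then
        (bseq k' n i n + bseq k' n i (n + 1))%Z
      else if Nat.eqb j (n + 1) then bseq k' n i 1
      else if Nat.leb (n + 2) j && Nat.leb j (2 * n) then bseq k' n i (2 * n + 2 - j)
      else 0%Z
  end.

Definition b (k i j n : nat) : Z := bseq (k - 1) n i j.

Definition c (k n : nat) : Z :=
  (sumZ (map (fun i => b k i i n) (seq 1 (2 * n)))
   + b k (n + 1) n n
   + sumZ (map (fun i => b k i (n + 1) n) (seq (n + 2) (n - 1))))%Z.

Definition phi_n (n : nat) (k : nat) : Z :=
  if Nat.eqb n 1 then lucas k else c k n.

Definition Phi (n m : nat) : Z := PhiGen m (phi_n n).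

Example lucas_test : map lucas [1;2;3;4;5]%nat = [1;3;4;7;11]%Z. Proof. reflexivity. Qed.
Example mob_test : map mobius [1;2;3;4;6;30;12]%nat = [1;-1;-1;0;1;-1;0]%Z. Proof. reflexivity. Qed.

(* Main.v *)
Require Import Defs.
From Stdlib Require Import Reals Lra Lia Arith ZArith List ClassicalEpsilon.
From mathcomp Require all_boot all_algebra zify ssrZ.
Open Scope R_scope.

(** An orbit of odd period 2n+1 for a map without smaller odd periods > 1 spirals outwards from its
    centre (Stefan's cycle), up to reflection: starting from the central gap J, the hull of the
    image grows by exactly one orbit point at each step, since faster growth, or a point that stays
    on its side of the centre, would give a closed walk through J of odd length < 2n+1 in the graph
    of intervals.  By the intermediate value theorem each primitive closed walk of length t in
    Stefan's graph carries a point of period t, and distinct walks carry distinct points off the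
    cycle; the closed walks of length d are counted by the trace of the d-th power of the
    adjacency matrix, which is phi_n d, and Moebius inversion leaves Phi n t primitive ones, in
    rotation classes of size t.  For k > 0 there is no odd period > 1, so the orbit exchanges its
    two halves and f^2, truncated to one half, reduces k by one.  Sharpness: in the piecewise
    affine map of Stefan's cycle two points with the same periodic itinerary coincide, and a
    square-root construction doubles all periods. *)

(** Of the assumption on [t], only [t / 2^k <> 2 n + 1] is finally used. A point of the cycle is an
    endpoint of two adjacent intervals, so it can fit several itineraries; for any other length an
    aperiodic itinerary stays in the open intervals, which are disjoint, and so it determines the
    period and tells orbits apart.

    For [k > 0] the interval spanned by one half of the orbit need not be mapped back to itself by
    f^2; this is the obstacle that truncation removes. Its danger, spurious periodic points, is
    absent because every truncated value is a point of the orbit. Since doubling respects the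
    ordering, the absence of preceding periods passes to the truncated map, and the same list of
    orbits serves at every level.

    A map of [a,b] is extended to the line by clamping its argument. All periodic points of the
    extension lie in [a,b], so mirror images, truncations and compositions need no bookkeeping of
    domains.

    In the doubling of the model map the two copies of the interval are separated by a gap whose
    only periodic points are fixed, and 1 is the last number of the ordering. *)

(* Positions are numbered from 0, so stefan n i + 1 is the image of the (i+1)-st point of the cycle. *)
Definition stefan (n i : nat) : nat :=
  if Nat.eqb i 0 then n else if Nat.leb i n then (2 * n + 1 - i)%nat else (2 * n - i)%nat.

(** Interval [i] joins the positions [i] and [i + 1]. Only the images of its endpoints enter, which
    is what the intermediate value theorem can exploit. *)
Definition covers (s : nat -> nat) (i j : nat) : Prop :=
  (s i <= j < s (S i) \/ s (S i) <= j < s i)%nat.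

(** A closed walk is a periodic function on all of [nat], so that changing its starting point is a
    shift of the argument. *)
Definition itinerary (n t : nat) (w : nat -> nat) : Prop :=
  (forall i, (w i < 2 * n)%nat /\ covers (stefan n) (w i) (w (S i))) /\
  (forall i, w (i + t)%nat = w i).

Definition aperiodic (t : nat) (w : nat -> nat) : Prop :=
  forall d, (0 < d < t)%nat -> exists i, w (i + d)%nat <> w i.

(** * Counting primitive closed walks in Stefan's graph *)

Module Necklaces.
Import all_boot all_algebra zify ssrZ.
Set Implicit Arguments. Unset Strict Implicit. Unset Printing Implicit Defensive.
Import GRing.Theory.
Local Open Scope nat_scope.

(** * Dictionary between the arithmetic of the statement and MathComp *)

Lemma modE m d : 0 < d -> Nat.modulo m d = m %% d.
Proof.
move=> d0; symmetry; apply: (Nat.mod_unique _ _ (m %/ d)).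
  by apply/ltP; rewrite ltn_pmod.
by rewrite {1}(divn_eq m d) mulnC.
Qed.

Lemma divE m d : 0 < d -> Nat.div m d = m %/ d.
Proof.
move=> d0; symmetry; apply: (Nat.div_unique _ _ _ (m %% d)).
  by apply/ltP; rewrite ltn_pmod.
by rewrite {1}(divn_eq m d) mulnC.
Qed.

Lemma divides_bE d m : divides_b d m = (d %| m).
Proof.
rewrite /divides_b; case: d => [|d]; first by rewrite dvd0n /=; case: m.
by rewrite modE //; apply/Nat.eqb_spec/eqP.
Qed.

Lemma list_seqE a k : List.seq a k = iota a k.
Proof. by elim: k a => //= k IH a; rewrite IH. Qed.

Lemma forallbE T (p : T -> bool) s : forallb p s = all p s.
Proof. by elim: s => //= x s ->. Qed.

Lemma is_prime_bE p : is_prime_b p = prime p.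
Proof.
rewrite /is_prime_b list_seqE forallbE.
apply/andP/primeP => [[/Nat.leb_le p2 /allP H]|[p1 H]].
  split; first by lia.
  move=> d dp; case: (eqVneq d 1) => //= d1.
  have d0 : d != 0 by apply: contraTneq dp => ->; rewrite dvd0n; lia.
  have dle : d <= p by apply: dvdn_leq => //; lia.
  apply: contraT => dnp.
  have /H : d \in iota 2 (p - 2) by rewrite mem_iota; lia.
  by rewrite divides_bE dp.
split; first by apply/Nat.leb_le; lia.
apply/allP => d; rewrite mem_iota divides_bE => dr; apply/negP => /H; lia.
Qed.

Lemma squarefree_bP m : 0 < m ->
  reflect (forall d, 1 < d -> ~~ (d * d %| m)) (squarefree_b m).
Proof.
move=> m0; rewrite /squarefree_b list_seqE forallbE.
apply: (iffP allP) => H d; last first.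
  by rewrite mem_iota divides_bE => hd; apply: H; lia.
move=> d1; apply/negP => dd.
have dm : d * d <= m by apply: dvdn_leq.
have : d \in iota 2 (m - 1) by rewrite mem_iota; nia.
by move/H; rewrite divides_bE dd.
Qed.

Lemma nprimefactorsE m : 0 < m -> nprimefactors m = size (primes m).
Proof.
move=> m0; rewrite /nprimefactors list_seqE.
have -> : forall s, length (List.filter (fun p => is_prime_b p && divides_b p m) s)
   = size [seq p <- s | prime p && (p %| m)].
  by elim=> //= x s IH; rewrite is_prime_bE divides_bE; case: ifP => //= _; rewrite IH.
apply: perm_size; apply: uniq_perm.
- by rewrite filter_uniq // iota_uniq.
- exact: primes_uniq.
move=> p; rewrite mem_filter mem_primes mem_iota m0 /=.
case pp: (prime p) => //=; case pm: (p %| m) => //=.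
have := dvdn_leq m0 pm; have := prime_gt1 pp; lia.
Qed.

(** * Sums of the Moebius function over divisors *)

Lemma mobius_sq0 e p : 0 < e -> prime p -> p %| e -> mobius (e * p) = 0%R.
Proof.
move=> e0 pp pe; rewrite /mobius; case: squarefree_bP => //.
  by rewrite muln_gt0 e0 prime_gt0.
by move/(_ p (prime_gt1 pp)); rewrite dvdn_mul.
Qed.

Lemma mobiusMp e p : 0 < e -> prime p -> ~~ (p %| e) -> mobius (e * p) = (- mobius e)%R.
Proof.
move=> e0 pp pe; have p0 := prime_gt0 pp.
have ep0 : 0 < e * p by rewrite muln_gt0 e0.
rewrite /mobius.
have -> : squarefree_b (e * p) = squarefree_b e.
  apply/squarefree_bP/squarefree_bP => // H d d1.
    by apply: contra (H d d1) => dd; rewrite dvdn_mulr.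
  case pd: (p %| d).
    apply: contra pe => dd; rewrite -(dvdn_pmul2r p0).
    by apply: dvdn_trans dd; apply: dvdn_mul.
  apply: contra (H d d1); rewrite Gauss_dvdl //.
  by rewrite coprimeMl coprime_sym prime_coprime // pd.
case: squarefree_bP => // _.
have -> : nprimefactors (e * p) = (nprimefactors e).+1.
  rewrite !nprimefactorsE // -[RHS]/(size (p :: primes e)).
  apply: perm_size; apply: uniq_perm; first exact: primes_uniq.
    by rewrite /= primes_uniq mem_primes (negPf pe) !andbF.
  move=> q; rewrite inE !mem_primes ep0 e0 /=.
  case: (eqVneq q p) => [->|qp] /=; first by rewrite pp dvdn_mull.
  case pq: (prime q) => //=; rewrite Euclid_dvdM // (dvdn_prime2 pq pp).
  by rewrite (negPf qp) orbF.
by rewrite Nat.even_succ -Nat.negb_even; case: Nat.even.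
Qed.

(** With [p] the least prime factor of [m], the divisors [e] and [e p] with [e] prime to [p] cancel
    in pairs, and the divisors containing p^2 contribute 0. *)
Lemma mobius_sum m : 0 < m ->
  (\sum_(d <- prime.divisors m) mobius d = (m == 1%N)%:R)%R.
Proof.
move=> m0; case: (ltnP 1 m) => [m1|mle]; last first.
  have -> : m = 1 by lia.
  by rewrite big_seq1.
have -> : (m == 1) = false by lia.
set p := pdiv m; have pp : prime p by apply: pdiv_prime.
have p0 := prime_gt0 pp.
have pm : p %| m by apply: pdiv_dvd.
have q0 : 0 < m %/ p by rewrite divn_gt0 // dvdn_leq.
have qp : m %/ p * p = m by rewrite divnK.
rewrite (bigID (fun d => p %| d)) /=.
have -> : (\sum_(d <- prime.divisors m | (p %| d)%N) mobius d
   = \sum_(e <- prime.divisors (m %/ p)%N) mobius (e * p)%N)%R.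
  rewrite -big_filter -(big_map (fun e => e * p) xpredT mobius).
  apply: perm_big; apply: uniq_perm.
  - by rewrite filter_uniq // divisors_uniq.
  - rewrite map_inj_uniq ?divisors_uniq // => a b /eqP; rewrite eqn_pmul2r // => /eqP //.
  move=> d; rewrite mem_filter -dvdn_divisors //; apply/andP/mapP.
    case=> pd dm; exists (d %/ p); last by rewrite divnK.
    by rewrite -dvdn_divisors // -(dvdn_pmul2r p0) qp divnK.
  case=> e; rewrite -dvdn_divisors // => em ->; split; first exact: dvdn_mull.
  by rewrite -qp dvdn_pmul2r.
rewrite (bigID (fun d => p %| d)) /= big1_seq ?add0r; last first.
  move=> e /andP[pe]; rewrite -dvdn_divisors // => em.
  apply: mobius_sq0 => //; apply: dvdn_gt0 em => //.
have -> : (\sum_(d <- prime.divisors m | (~~ (p %| d))%N) mobius d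
   = \sum_(e <- prime.divisors (m %/ p)%N | (~~ (p %| e))%N) mobius e)%R.
  rewrite -[LHS]big_filter -[RHS]big_filter.
  apply: perm_big; apply: uniq_perm; rewrite ?filter_uniq ?divisors_uniq //.
  move=> d; rewrite !mem_filter -!dvdn_divisors //.
  case pd: (p %| d) => //=.
  by rewrite -{1}qp Gauss_dvdl // coprime_sym prime_coprime // pd.
rewrite -big_split /= big1_seq // => e /andP[pe]; rewrite -dvdn_divisors // => em.
rewrite mobiusMp //; last exact: dvdn_gt0 em.
exact: addNr.
Qed.

(** The substitution [e = t / d] turns the multiples [d] of [o] dividing [t] into the divisors of
    [t / o]. *)
Lemma mobius_sum_between o t : 0 < t -> o %| t ->
  (\sum_(d <- prime.divisors t | (o %| d)%N) mobius (t %/ d)%N = (o == t)%:R)%R.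
Proof.
move=> t0 ot; have o0 := dvdn_gt0 t0 ot.
have q0 : 0 < t %/ o by rewrite divn_gt0 // dvdn_leq.
have -> : (o == t) = (t %/ o == 1).
  by rewrite -[in LHS](divnK ot) -{1}(mul1n o) eqn_pmul2r // eq_sym.
rewrite -mobius_sum // -big_filter -(big_map (fun d => t %/ d) xpredT mobius).
apply: perm_big; apply: uniq_perm.
- rewrite map_inj_in_uniq ?filter_uniq ?divisors_uniq // => a b.
  rewrite !mem_filter -!dvdn_divisors // => /andP[_ ha] /andP[_ hb] E.
  by have := divnK ha; have := divnK hb; rewrite E; nia.
- exact: divisors_uniq.
move=> e; rewrite -dvdn_divisors //; apply/mapP/idP.
  case=> d; rewrite mem_filter -dvdn_divisors // => /andP[od dt] ->.
  have d0 := dvdn_gt0 t0 dt.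
  by rewrite -(dvdn_pmul2r o0) divnK // -(dvdn_pmul2l d0) mulnA [d * _]mulnC divnK // mulnC dvdn_pmul2r.
move=> et; have e0 := dvdn_gt0 q0 et.
have eot : e * o %| t by rewrite -(divnK ot) dvdn_pmul2r.
have et' : e %| t by apply: dvdn_trans eot; apply: dvdn_mulr.
exists (t %/ e); last by rewrite divnA // mulKn.
rewrite mem_filter -dvdn_divisors // dvdn_divRL // mulnC eot /=.
by rewrite -{2}(divnK et') dvdn_mulr.
Qed.

Lemma sumZE (s : list nat) F : sumZ (List.map F s) = (\sum_(d <- s) F d)%R.
Proof.
rewrite /sumZ; elim: s => [|x s IH] /=; first by rewrite big_nil.
by rewrite big_cons IH.
Qed.

Lemma PhiGenE m phi : 0 < m ->
  PhiGen m phi = (\sum_(d <- prime.divisors m) mobius (m %/ d)%N * phi d)%R.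
Proof.
move=> m0; rewrite /PhiGen sumZE.
have -> : Defs.divisors m = [seq d <- iota 1 m | (d %| m)%N].
  rewrite /Defs.divisors list_seqE; elim: (iota 1 m) => //= x s ->.
  by rewrite divides_bE.
rewrite (perm_big (prime.divisors m)) /=; last first.
  apply: uniq_perm; rewrite ?filter_uniq ?iota_uniq ?divisors_uniq //.
  move=> d; rewrite mem_filter mem_iota -dvdn_divisors //.
  case dm: (d %| m) => //=; have := dvdn_leq m0 dm; have := dvdn_gt0 m0 dm; lia.
apply: eq_big_seq => d; rewrite -dvdn_divisors // => dm.
by rewrite divE // (dvdn_gt0 m0 dm).
Qed.

(** * Periodic words under rotation *)

Section Shift.
Variables (V : finType) (e : rel V) (t : nat).
Notation T := {ffun 'I_t.+1 -> V}.
Implicit Types w : T.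

(** Words have [t.+1] letters, so that the index type is nonempty and [inord] is available. *)
Definition ext w (i : nat) : V := w (inord (i %% t.+1)).
Definition trunc (v : nat -> V) : T := [ffun i : 'I_t.+1 => v i].

Lemma ext_trunc v : (forall i, v (i + t.+1) = v i) -> ext (trunc v) =1 v.
Proof.
move=> H i; rewrite /ext ffunE inordK ?ltn_pmod // {2}(divn_eq i t.+1).
elim: (i %/ t.+1) => [|k IH]; first by rewrite mul0n.
by rewrite mulSn -addnA [t.+1 + _]addnC H.
Qed.

Lemma ext_period w i : ext w (i + t.+1) = ext w i.
Proof. by rewrite /ext modnDr. Qed.

Lemma ext_periodM w i k : ext w (i + k * t.+1) = ext w i.
Proof. by rewrite /ext addnC modnMDl. Qed.

Lemma extK w : trunc (ext w) = w.
Proof. by apply/ffunP => i; rewrite ffunE /ext modn_small // inord_val. Qed.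

Lemma ext_inj w w' : ext w =1 ext w' -> w = w'.
Proof. by move=> H; rewrite -(extK w) -(extK w'); apply/ffunP => i; rewrite !ffunE H. Qed.

Definition shift w : T := trunc (fun i => ext w i.+1).

Lemma ext_iter_shift k w i : ext (iter k shift w) i = ext w (i + k).
Proof.
elim: k i => [|k IH] i /=; first by rewrite addn0.
by rewrite ext_trunc => [|j]; rewrite -?addSn ?ext_period // IH addSnnS.
Qed.

Lemma shift_inj : injective shift.
Proof.
move=> w w' H; apply: ext_inj => i.
rewrite -(ext_period w) -(ext_period w') addnS -addSn.
have H' k : ext w k.+1 = ext w' k.+1.
  by rewrite -addn1 -!(ext_iter_shift 1) /= H.
by rewrite addSn !H'.
Qed.

Definition is_loop w := [forall i : 'I_t.+1, e (ext w i) (ext w i.+1)].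

Lemma is_loopP w : reflect (forall i, e (ext w i) (ext w i.+1)) (is_loop w).
Proof.
apply: (iffP forallP) => H i; last exact: H.
have := H (inord (i %% t.+1)); rewrite inordK ?ltn_pmod //.
have -> : ext w i = ext w (i %% t.+1).
  by rewrite [in LHS](divn_eq i t.+1) addnC ext_periodM.
suff -> : ext w i.+1 = ext w (i %% t.+1).+1 by [].
by rewrite [in LHS](divn_eq i t.+1) addnC -addSn ext_periodM.
Qed.

Lemma is_loop_shift w : is_loop (shift w) = is_loop w.
Proof.
have E i : ext (shift w) i = ext w (i + 1) by apply: (ext_iter_shift 1).
apply/is_loopP/is_loopP => H i; last by rewrite !E !addn1.
(* Index [i + t] plays the part of [i - 1], the period being [t.+1]. *)
have := H (i + t); rewrite !E.
have -> : i + t + 1 = i + t.+1 by lia.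
have -> : (i + t).+1 + 1 = i.+1 + t.+1 by lia.
by rewrite !ext_period.
Qed.

Lemma iter_order_dvd w d : (iter d shift w == w) = (order shift w %| d).
Proof.
have I k : iter (k * order shift w) shift w = w.
  elim: k => // k IH; rewrite mulSn iterD IH; apply: iter_order; exact: shift_inj.
rewrite {1}(divn_eq d (order shift w)) addnC iterD I /dvdn.
have : d %% order shift w < order shift w by rewrite ltn_pmod // order_gt0.
move: (d %% _) => r hr; apply/eqP/eqP => [|->] // E.
have := findex_iter hr; rewrite E => <-; exact: findex0.
Qed.

Lemma iter_shift_period w : iter t.+1 shift w = w.
Proof. by apply: ext_inj => i; rewrite ext_iter_shift ext_period. Qed.

End Shift.

(** A word fixed by rotation through [d.+1] places repeats its first [d.+1] letters, and these form
    a closed walk on their own. *)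
Lemma card_loops_fixed (V : finType) (e : rel V) t d : d.+1 %| t.+1 ->
  #|[set w : {ffun 'I_t.+1 -> V} | is_loop e w && (iter d.+1 (@shift V t) w == w)]|
  = #|[set w : {ffun 'I_d.+1 -> V} | is_loop e w]|.
Proof.
move=> /dvdnP[q Eq].
have P (u : {ffun 'I_d.+1 -> V}) : ext (trunc t (ext u)) =1 ext u.
  by apply: ext_trunc => i; rewrite Eq ext_periodM.
rewrite -[RHS](card_in_imset (f := fun u => trunc t (ext u))).
  apply: eq_card => w; rewrite !inE; apply/idP/imsetP.
    move=> /andP[/is_loopP wl /eqP wf].
    have H : ext (trunc d (ext w)) =1 ext w.
      by apply: ext_trunc => i; rewrite -ext_iter_shift wf.
    exists (trunc d (ext w)).
      by rewrite inE; apply/is_loopP => i; rewrite !H.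
    by apply: ext_inj => i; rewrite P H.
  case=> u; rewrite inE => /is_loopP ul ->.
  apply/andP; split; first by apply/is_loopP => i; rewrite !P.
  by apply/eqP/ext_inj => i; rewrite ext_iter_shift !P ext_period.
by move=> u u' _ _ H; apply: ext_inj => i; rewrite -P H P.
Qed.

(** For [d > 0] these are words of [d] letters; [d.-1.+1] only exhibits the successor that [is_loop]
    expects. *)
Definition nloops (V : finType) (e : rel V) d := #|[set w : {ffun 'I_d.-1.+1 -> V} | is_loop e w]|.

(** After exchanging the sums, a closed walk whose rotation class has [o] elements is counted with
    the sum of mu(t/d) over [o | d | t], which vanishes unless [o = t] (here [t] stands for
    [t.+1]). *)
Lemma moebius_count (V : finType) (e : rel V) t :
  (\sum_(d <- prime.divisors t.+1) mobius (t.+1 %/ d)%N * Z.of_nat (nloops e d))%R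
  = Z.of_nat #|[set w : {ffun 'I_t.+1 -> V} | is_loop e w & order (@shift V t) w == t.+1]|.
Proof.
have cardZ (T : finType) (A : {pred T}) : Z.of_nat #|A| = (\sum_(x in A) 1 :> Z)%R.
  by rewrite sumr_const; elim: #|A| => // k IH; rewrite mulrS -IH; lia.
transitivity (\sum_(d <- prime.divisors t.+1) \sum_(w : {ffun 'I_t.+1 -> V} | is_loop e w && (order (@shift V t) w %| d)%N) mobius (t.+1 %/ d)%N)%R.
  apply: eq_big_seq => d; rewrite -dvdn_divisors // => dt.
  have d0 := dvdn_gt0 (ltn0Sn t) dt.
  rewrite /nloops -(@card_loops_fixed _ _ t) prednK // cardZ mulr_sumr.
  by apply: eq_big => [w|w _]; rewrite ?mulr1 // inE iter_order_dvd.
rewrite (exchange_big_dep (fun w : {ffun 'I_t.+1 -> V} => is_loop e w)) /=; last by move=> d w _ /andP[].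
rewrite cardZ big_mkcond [RHS]big_mkcond /=; apply: eq_bigr => w _; rewrite inE.
case: ifP => //= wl; rewrite (eq_bigl (fun d => (order (@shift V t) w %| d)%N)); last by move=> d; rewrite wl.
rewrite mobius_sum_between //; first by case: eqP.
by rewrite -iter_order_dvd iter_shift_period.
Qed.

(** * Closed walks as the trace of a power of the adjacency matrix *)

Fixpoint nwalks (V : finType) (e : rel V) k (i j : V) : nat :=
  if k is k'.+1 then \sum_l e i l * nwalks e k' l j else (i == j).

(** The definition splits off the first edge, whereas the recurrence for b_{k,i,j} changes the end
    point [j] and hence the last edge. *)
Lemma nwalksSr (V : finType) (e : rel V) k i j :
  nwalks e k.+1 i j = \sum_l nwalks e k i l * e l j.
Proof.
elim: k i j => [|k IH] i j.
  rewrite /= (bigD1 j) //= eqxx muln1 big1 ?addn0; last first.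
    by move=> l /negPf lj; rewrite lj muln0.
  rewrite (bigD1 i) //= eqxx mul1n big1 ?addn0 // => l.
  by rewrite eq_sym => /negPf ->.
rewrite [LHS]/= -/(nwalks e k.+1).
under eq_bigr => l _ do rewrite -/(nwalks e k.+1 l j) IH big_distrr /=.
rewrite exchange_big /=; apply: eq_bigr => l _.
by rewrite big_distrl /=; apply: eq_bigr => m _; rewrite mulnA.
Qed.

Lemma card_walks (V : finType) (e : rel V) k i j :
  \sum_(p : k.-tuple V) (path e i p && (last i p == j)) = nwalks e k i j.
Proof.
elim: k i => [|k IH] i.
  rewrite (big_pred1 [tuple]) //= => p; apply/esym/eqP; exact: tuple0.
rewrite (reindex (fun x : V * k.-tuple V => cons_tuple x.1 x.2)); last first.
  exists (fun p : k.+1.-tuple V => (thead p, behead_tuple p)) => [[x p] _|p _] /=.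
    by rewrite theadE; congr pair; apply: val_inj.
  by apply: val_inj; rewrite /= [in RHS](tuple_eta p).
rewrite -(pair_bigA_idem _ (fun l p => nat_of_bool (path e i (cons_tuple l p) && (last i (cons_tuple l p) == j)))) //=.
apply: eq_bigr => l _; rewrite -IH big_distrr /=; apply: eq_bigr => p _.
by case: (e i l); rewrite ?mul1n.
Qed.

Lemma nloops_trace (V : finType) (e : rel V) d : 0 < d ->
  nloops e d = \sum_i nwalks e d i i.
Proof.
case: d => // d _; rewrite /nloops /=.
under eq_bigr => i _ do rewrite -/(nwalks e d.+1 i i) -card_walks.
rewrite exchange_big /= -sum1_card big_mkcond /=.
rewrite (reindex (fun p : d.+1.-tuple V => [ffun i => tnth p i])); last first.
  exists (fun w : {ffun 'I_d.+1 -> V} => [tuple w i | i < d.+1]) => [p _|w _].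
    by apply: eq_from_tnth => i; rewrite tnth_mktuple ffunE.
  by apply/ffunP => i; rewrite ffunE tnth_mktuple.
apply: eq_bigr => p _; rewrite inE.
set w := [ffun i => _]; set x0 := thead p.
have E i : i < d.+1 -> ext w i = nth x0 p i.
  by move=> hi; rewrite /ext ffunE modn_small // (tnth_nth x0) inordK.
have sp := size_tuple p.
have L i : last i p = nth x0 p d.
  by move: (x0) sp => x1; case: (tval p) => [|y q] //= [<-]; rewrite (last_nth x1).
(* A tuple is counted for one base point only, its last letter, which cyclically precedes the
   first. *)
rewrite (bigD1 (nth x0 p d)) //= big1 ?addn0; last first.
  by move=> i /negPf ip; rewrite L eq_sym ip andbF.
rewrite L eqxx andbT.
have -> : is_loop e w = path e (nth x0 p d) p.
  apply/is_loopP/(pathP x0) => H i; rewrite ?sp.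
    case: i => [|i] hi /=; last by rewrite -(E _ (ltnW hi)) -(E _ hi).
    by rewrite -(E d) // -(E 0) // -[ext w 0]ext_period add0n.
  suff K k : k < d.+1 -> e (ext w k) (ext w k.+1).
    have := K (i %% d.+1) (ltn_pmod _ (ltn0Sn d)).
    have -> : ext w i = ext w (i %% d.+1).
      by rewrite [in LHS](divn_eq i d.+1) addnC ext_periodM.
    suff -> : ext w i.+1 = ext w (i %% d.+1).+1 by [].
    by rewrite [in LHS](divn_eq i d.+1) addnC -addSn ext_periodM.
  move=> kd; case: (ltnP k.+1 d.+1) => [kd'|dk].
    by rewrite !E //; have := H k.+1; rewrite sp => /(_ kd').
  have -> : k = d by lia.
  by rewrite -[d.+1]add0n ext_period !E //; have := H 0; rewrite sp => /(_ isT).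
by case: path.
Qed.

(** * Stefan's graph and the numbers b and c *)

Lemma lebE a b : Nat.leb a b = (a <= b).
Proof. by apply/Nat.leb_spec0/idP; lia. Qed.

Lemma eqbE a b : Nat.eqb a b = (a == b).
Proof. by apply/Nat.eqb_spec/eqP. Qed.

Definition coversb n (i j : nat) : bool :=
  (stefan n i <= j < stefan n i.+1) || (stefan n i.+1 <= j < stefan n i).

Lemma coversP n i j : reflect (covers (stefan n) i j) (coversb n i j).
Proof.
rewrite /covers /coversb.
by apply: (iffP orP) => -[]; move=> ?; [left|right|left|right]; lia.
Qed.

Definition edge n : rel 'I_(2 * n) := fun i j => coversb n i j.

(** The graph is read backwards here: walks ending at [j] are extended from walks ending at the
    predecessors of [j]. *)
Lemma coversb_pred n l j : 1 < n -> l < 2 * n -> j < 2 * n ->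
  coversb n l j = if j.+1 < n then l == 2 * n - 1 - j else if j.+1 == n then l == n
    else (l == 0) || (l == if j == n then n else 2 * n - j).
Proof.
move=> n1 hl hj; rewrite /coversb /stefan !lebE !eqbE; repeat case: ifP => ?; lia.
Qed.

Lemma bseq0 n i j : Defs.bseq 0 n i j = if inQ n i j then 1%R else 0%R.
Proof. by []. Qed.

Section Bseq.
Variables (n k i : nat).
Hypothesis n1 : 1 < n.

Lemma bseqS j : Defs.bseq k.+1 n i j =
  if (1 <= j) && (j <= n - 1) then (Defs.bseq k n i (2 * n + 1 - j)%N + Defs.bseq k n i (n + 1)%N)%R
  else if j == n then (Defs.bseq k n i n + Defs.bseq k n i (n + 1)%N)%R
  else if j == n + 1 then Defs.bseq k n i 1
  else if (n + 2 <= j) && (j <= 2 * n) then Defs.bseq k n i (2 * n + 2 - j) else 0%R.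
Proof. by rewrite -!lebE -!eqbE. Qed.

Lemma bseqS_lo j : 1 <= j < n ->
  Defs.bseq k.+1 n i j = (Defs.bseq k n i (2 * n + 1 - j)%N + Defs.bseq k n i (n + 1)%N)%R.
Proof. by move=> hj; rewrite bseqS; repeat case: ifP => //; lia. Qed.

Lemma bseqS_n : Defs.bseq k.+1 n i n = (Defs.bseq k n i n + Defs.bseq k n i (n + 1)%N)%R.
Proof. by rewrite bseqS; repeat case: ifP => //; lia. Qed.

Lemma bseqS_n1 : Defs.bseq k.+1 n i (n + 1) = Defs.bseq k n i 1.
Proof. by rewrite bseqS; repeat case: ifP => //; lia. Qed.

Lemma bseqS_hi j : n + 2 <= j <= 2 * n ->
  Defs.bseq k.+1 n i j = Defs.bseq k n i (2 * n + 2 - j).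
Proof. by move=> hj; rewrite bseqS; repeat case: ifP => //; lia. Qed.
End Bseq.

(* The numbers b_{k,i,j} count images of lumped intervals (1-based): j = n stands for the union of
   the intervals n and n+1, and j = n+1 for the union of the intervals n+1, ..., 2n. *)
Lemma nwalks_bseq n k (i j : 'I_(2 * n)) : 1 < n ->
  Z.of_nat (nwalks (@edge n) k.+1 i j) =
    if j < n then Defs.bseq k n i.+1 j.+1
    else (Defs.bseq k n i.+1 (n + 1) + Defs.bseq k n i.+1 (if j == n :> nat then n else j.+1))%R.
Proof.
move=> n1; elim: k j => [|k IH] j.
  rewrite nwalksSr (bigD1 i) //= eqxx mul1n big1 ?addn0; last first.
    by move=> l; rewrite eq_sym => /negPf ->.
  rewrite /edge coversb_pred // ?bseq0 /inQ !lebE !eqbE.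
  move: (ltn_ord i) (ltn_ord j); move: (nat_of_ord i) (nat_of_ord j) => a b ha hb.
  repeat (case: ifP => ?); lia.
have S1 (F : 'I_(2 * n) -> nat) (a : 'I_(2 * n)) : \sum_l F l * (l == a :> nat) = F a.
  rewrite (bigD1 a) //= eqxx muln1 big1 ?addn0 // => l la.
  by rewrite (_ : (l == a :> nat) = false) ?muln0 //; move/negPf: la.
have Z0 (F : 'I_(2 * n) -> nat) a : a < 2 * n ->
    exists2 b : 'I_(2 * n), b = a :> nat & \sum_l F l * (l == a :> nat) = F b.
  by move=> ha; exists (Ordinal ha); [|exact: (S1 F (Ordinal ha))].
rewrite nwalksSr /edge; have hj := ltn_ord j.
under eq_bigr => l _ do rewrite coversb_pred //.
set W := fun l => nwalks (@edge n) k.+1 i l.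
case: (ltnP j.+1 n) => jn.
  have [|b bE] := Z0 W (2 * n - 1 - j); first lia.
  rewrite -/W => ->; rewrite /W IH bE bseqS_lo //.
  have -> : (j < n) = true by lia.
  have -> : (2 * n - 1 - j < n) = false by lia.
  have -> : (2 * n - 1 - j == n) = false by lia.
  have -> : (2 * n - 1 - j).+1 = 2 * n + 1 - j.+1 by lia.
  by rewrite addrC.
case: (eqVneq j.+1 n) => [jn1|jn1].
  have [|b bE] := Z0 W n; first lia.
  rewrite -/W => ->; rewrite /W IH bE.
  have -> : (j < n) = true by lia.
  by rewrite ltnn eqxx jn1 bseqS_n // addrC.
have -> : (j < n) = false by lia.
have nn : (if j == n :> nat then n else 2 * n - j) < 2 * n by case: ifP; lia.
have [|b0 b0E E0] := Z0 W 0; first lia.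
have [b bE E] := Z0 W _ nn.
transitivity (Z.of_nat (W b0 + W b)).
  congr Z.of_nat; rewrite -E0 -E -big_split /=; apply: eq_bigr => l _.
  rewrite -mulnDr; congr (_ * _).
  by case: (ifP (j == n :> nat)) => jn2; case: (eqVneq (l : nat) 0) => [->|l0] /=; lia.
rewrite Nat2Z.inj_add /W !IH b0E bE.
have -> : (0 < n) = true by lia.
rewrite bseqS_n1 //; congr (_ + _)%R.
case: (eqVneq (j : nat) n) => jn2; first by rewrite ltnn eqxx bseqS_n // addrC.
have hj3 : n + 2 <= j.+1 <= 2 * n by lia.
rewrite bseqS_hi //.
have -> : (2 * n - j < n) = true by lia.
by congr Defs.bseq; lia.
Qed.

Lemma sum_ord_sumZ F a m :
  (\sum_(i < m) F (a + i)%N)%R = sumZ (List.map F (List.seq a m)).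
Proof.
elim: m a => [|m IH] a; first by rewrite big_ord0.
rewrite big_ord_recl addn0 /= -IH; congr (_ + _)%R.
by apply: eq_bigr => i _; rewrite /bump addSnnS.
Qed.

Lemma Zof_nat_sum (I : finType) (F : I -> nat) :
  Z.of_nat (\sum_i F i) = (\sum_i Z.of_nat (F i))%R.
Proof. by apply: (big_morph Z.of_nat) => // x y; rewrite Nat2Z.inj_add. Qed.

Lemma trace_c n k : 1 < n -> 0 < k ->
  Z.of_nat (\sum_i nwalks (@edge n) k i i) = Defs.c k n.
Proof.
move=> n1; case: k => // k _; rewrite /Defs.c.
have bE i j : Defs.b k.+1 i j n = Defs.bseq k n i j by rewrite /Defs.b; congr Defs.bseq; lia.
rewrite -!sum_ord_sumZ bE Zof_nat_sum.
(* Undoing the lumping adds b_{k,n+1,n} to the diagonal entry of row n+1 and b_{k,i,n+1} to that of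
   each later row [i]: these are the two extra terms of c_{k,n}. *)
pose G i := if i < n then 0%R else if i == n then Defs.bseq k n n.+1 n else Defs.bseq k n i.+1 (n + 1).
transitivity (\sum_(i < 2 * n) (Defs.bseq k n i.+1 i.+1 + G i))%R.
  apply: eq_bigr => i _; rewrite nwalks_bseq // /G; case: ifP => // ni; first by rewrite addr0.
  case: eqP => [->|]; last by rewrite addrC.
  by rewrite addn1.
rewrite big_split /= -Z.add_assoc; congr (_ + _)%R.
  by apply: eq_bigr => i _; rewrite bE.
rewrite -(big_mkord xpredT G) (@big_cat_nat _ _ _ n) //=; last lia.
rewrite big_nat big1 ?add0r; last by move=> i /andP[_ ilt]; rewrite /G ilt.
rewrite big_ltn; last lia.
congr (_ + _)%R; first by rewrite /G ltnn eqxx; congr Defs.bseq; lia.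
rewrite -{1}[n.+1]add0n big_addn big_mkord.
have -> : 2 * n - n.+1 = (n - 1)%coq_nat by lia.
apply: eq_bigr => i _; rewrite bE /G ifF ?ifF; try lia.
by congr Defs.bseq; lia.
Qed.

(** For [n = 1] the adjacency matrix has rows (0,1) and (1,1) and satisfies A^2 = A + 1, so its
    traces obey the Fibonacci recurrence. *)
Lemma trace_lucas k : 0 < k -> Z.of_nat (\sum_i nwalks (@edge 1) k i i) = Defs.lucas k.
Proof.
case: k => // k _; rewrite /Defs.lucas.
have -> : (k.+1 - 1)%coq_nat = k by lia.
pose tr k := \sum_i nwalks (@edge 1) k i i.
rewrite -/(tr k.+1).
have rec i : tr i.+2 = tr i.+1 + tr i.
  pose o0 : 'I_(2 * 1) := Ordinal (isT : 0 < 2); pose o1 : 'I_(2 * 1) := Ordinal (isT : 1 < 2).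
  have S (F : 'I_(2 * 1) -> nat) : \sum_i F i = F o0 + F o1.
    by rewrite !big_ord_recl big_ord0 addn0; congr (F _ + F _); apply: val_inj.
  by rewrite /tr !S /= !S /= /edge /coversb /= ?mul0n ?mul1n ?add0n; lia.
suff -> : Defs.lucas_aux k = (Z.of_nat (tr k.+1), Z.of_nat (tr k.+2)) by [].
elim: k => [|k IH]; last by rewrite [LHS]/= IH; congr pair; rewrite (rec k.+1) Nat2Z.inj_add Z.add_comm.
congr pair; rewrite ?rec /tr /=; do ?rewrite !big_ord_recl ?big_ord0 /=.
- by [].
by [].
Qed.

Lemma nloops_phi n k : 0 < n -> 0 < k -> Z.of_nat (nloops (@edge n) k) = Defs.phi_n n k.
Proof.
move=> n0 k0; rewrite nloops_trace // /Defs.phi_n eqbE; case: eqP => [->|n1].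
  exact: trace_lucas.
by apply: trace_c => //; lia.
Qed.

(** * Representatives of the rotation classes *)

Lemma list_nthE T (d : T) s i : List.nth i s d = nth d s i.
Proof. by elim: s i => [|x s IH] [|i] //=. Qed.

(** The list holds one root of each rotation orbit of primitive closed walks. All these orbits have
    exactly [t] elements, which gives the product formula. *)
Lemma necklaces n t : le 1 n -> le 1 t ->
  exists L : list (nat -> nat),
    (forall w, List.In w L -> itinerary n t w /\ aperiodic t w) /\
     (forall i j d, lt i (length L) -> lt j (length L) -> i <> j ->
       exists k, List.nth i L id (k + d) <> List.nth j L id k) /\
     (forall w, itinerary n t w -> aperiodic t w ->
       exists v d, List.In v L /\ (forall k, w (k + d) = v k)) /\
     Z.of_nat (length L * t) = Defs.Phi n t.
Proof.
move=> n0' t0'; have n0 : 0 < n by lia.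
have {t0'} [t' ->] : exists t', t = t'.+1 by exists t.-1; lia.
pose V := 'I_(2 * n); pose sh := @shift V t'.
have shI : injective sh by apply: shift_inj.
pose A := [set w : {ffun 'I_t'.+1 -> V} | is_loop (@edge n) w & order sh w == t'.+1].
have Aclosed : fclosed sh A.
  apply: intro_closed; first exact: fconnect_sym.
  move=> w w' /= /eqP <-; rewrite !inE is_loop_shift => /andP[-> /eqP ow] /=.
  suff -> : order sh (sh w) = order sh w by rewrite ow.
  by apply: eq_card => z; rewrite !inE; apply: esym; apply: same_fconnect1.
have Acard : fcard sh A * t'.+1 = #|A|.
  by apply: fcard_order_set => //; apply/subsetP => w; rewrite !inE => /andP[].
pose B := [pred w in froots sh | w \in A].
pose f (w : {ffun 'I_t'.+1 -> V}) (i : nat) : nat := ext w i.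
exists [seq f w | w <- enum B]; split; [|split; [|split]].
- move=> w wL.
  have {wL} [u uB ->] : exists2 u, u \in B & w = f u.
    have : forall s, List.In w [seq f w | w <- s] -> exists2 u, u \in s & w = f u.
      elim=> //= x s IH [<-|/IH [u us ->]]; first by exists x; rewrite ?mem_head.
      by exists u; rewrite // inE us orbT.
    by case/(_ _ wL) => u; rewrite mem_enum => uB ->; exists u.
  case/andP: uB => _; rewrite inE => /andP[/is_loopP ul /eqP uo].
  split; first split.
  + by move=> i; split; [apply/ltP; exact: ltn_ord|exact/coversP/ul].
  + by move=> i; rewrite /f ext_period.
  move=> d dt; case: (boolP [forall i : 'I_t'.+1, f u (i + d) == f u i]) => [/forallP H|].
    have E : iter d sh u = u.
      rewrite -[RHS]extK -[LHS]extK; apply/ffunP => i.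
      by rewrite !ffunE ext_iter_shift; apply: val_inj; move/eqP: (H i).
    have := iter_order_dvd u d; rewrite -/sh E eqxx uo => /esym /(dvdn_leq _); lia.
  by rewrite negb_forall => /existsP[i /eqP]; exists i.
- move=> i j d; rewrite !list_nthE.
  have -> : forall T (s : seq T), length s = size s by [].
  rewrite size_map => /ltP hi /ltP hj ij.
  have [x0 _] : exists x : {ffun 'I_t'.+1 -> V}, True by case: (enum B) hi => // x; exists x.
  rewrite !(nth_map x0) //.
  set x := nth x0 _ i; set y := nth x0 _ j.
  have xB : x \in B by rewrite -mem_enum mem_nth.
  have yB : y \in B by rewrite -mem_enum mem_nth.
  case: (boolP [forall k : 'I_t'.+1, f x (k + d) == f y k]) => [/forallP H|]; last first.
    by rewrite negb_forall => /existsP[k /eqP]; exists k.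
  have E : iter d sh x = y.
    rewrite -[RHS]extK -[LHS]extK; apply/ffunP => k.
    by rewrite !ffunE ext_iter_shift; apply: val_inj; move/eqP: (H k).
  case: ij; apply/eqP; rewrite -(nth_uniq x0 hi hj) ?enum_uniq //; apply/eqP.
  case/andP: xB => /eqP rx _; case/andP: yB => /eqP ry _.
  rewrite -/x -/y -rx -ry.
  by apply/(fingraph.rootP (fconnect_sym shI)); rewrite -E; exact: fconnect_iter.
- move=> w [wl wp] wprim.
  have n2 : 0 < 2 * n by lia.
  (* The default value of [insubd] never occurs, as all entries of [w] are below [2 * n]. *)
  pose v i : V := insubd (Ordinal n2) (w i).
  have vE i : v i = w i :> nat by rewrite val_insubd; have [] := wl i; case: ifP; lia.
  pose u := trunc t' v.
  have uE : ext u =1 v by apply: ext_trunc => i; apply: val_inj; rewrite /= !vE wp.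
  have uA : u \in A.
    rewrite inE; apply/andP; split.
      by apply/is_loopP => i; rewrite !uE; apply/coversP; rewrite !vE; have [] := wl i.
    have od : order sh u %| t'.+1 by rewrite /sh -iter_order_dvd iter_shift_period.
    have := dvdn_leq (ltn0Sn _) od; rewrite leq_eqVlt => /orP[//|ot].
    have [|i []] := wprim (order sh u); first by have := order_gt0 sh u; lia.
    by rewrite -!vE -!uE -ext_iter_shift iter_order.
  exists (f (froot sh u)), (findex sh u (froot sh u)); split.
    have : froot sh u \in enum B.
      rewrite mem_enum; apply/andP; split.
        exact: (fingraph.roots_root (fconnect_sym shI)).
      by rewrite -(closed_connect Aclosed (connect_root _ u)).
    elim: (enum B) => //= x s IH; rewrite inE => /orP[/eqP ->|/IH]; by [left|right].
  move=> k; rewrite -vE -uE -ext_iter_shift /f iter_findex //; exact: connect_root.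
have -> : length [seq f w | w <- enum B] = size [seq f w | w <- enum B] by [].
rewrite size_map -cardE.
have -> : #|B| * t'.+1 = #|A| by rewrite -Acard; congr (_ * _); apply: eq_card => w; rewrite !inE.
rewrite /Defs.Phi PhiGenE // -moebius_count; apply: eq_big_seq => d.
rewrite -dvdn_divisors // => dt; rewrite nloops_phi //; exact: dvdn_gt0 dt.
Qed.

End Necklaces.

(** * Iterates, the intermediate value theorem and closed walks *)

Lemma fiter_add F m n x : fiter (m + n) F x = fiter m F (fiter n F x).
Proof. induction m as [|m IH]; simpl; [reflexivity | now rewrite IH]. Qed.

Lemma fiter_mul F m q x : fiter m F x = x -> fiter (q * m) F x = x.
Proof.
intro H. induction q as [|q IH]; [reflexivity|].
simpl (S q * m)%nat. now rewrite fiter_add, IH.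
Qed.

Lemma min_period_divide F m r x :
  min_period F m x -> fiter r F x = x -> Nat.divide m r.
Proof.
intros [m1 [mx H]] rx.
assert (E : r = (r mod m + (r / m) * m)%nat) by (pose proof (Nat.div_mod_eq r m); lia).
rewrite E, fiter_add, fiter_mul in rx by assumption.
assert (r mod m < m)%nat by (apply Nat.mod_upper_bound; lia).
destruct (Nat.eq_dec (r mod m) 0) as [z|z].
- exists (r / m)%nat. lia.
- exfalso. apply (H (r mod m)%nat); [lia | assumption].
Qed.

Lemma min_period_exists F r x : (1 <= r)%nat -> fiter r F x = x ->
  exists d, min_period F d x /\ Nat.divide d r.
Proof.
intros r1 rx.
assert (K : exists d, min_period F d x).
{ revert r1 rx. induction r as [r IH] using lt_wf_ind. intros r1 rx.
  destruct (classic (exists j, (0 < j < r)%nat /\ fiter j F x = x)) as [[j [jr jx]]|N].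
  - apply (IH j); [lia | lia | assumption].
  - exists r. split; [lia | split; [assumption|]].
    intros j jr jx. apply N. exists j. now split. }
destruct K as [d D]. exists d. split; [assumption | now apply (min_period_divide F _ _ x)].
Qed.

(** A return of the [j]-th iterate is carried to a return of [x] itself by [m j - j] further
    steps. *)
Lemma min_period_iter F m j x : min_period F m x -> min_period F m (fiter j F x).
Proof.
intros [m1 [mx H]]. split; [assumption | split].
- now rewrite <- fiter_add, Nat.add_comm, fiter_add, mx.
- intros i im E. apply (H i im).
  assert (B : fiter (m * j) F x = x).
  { rewrite Nat.mul_comm. now apply fiter_mul. }
  assert (D : (m * j = (m * j - j) + j)%nat) by nia.
  rewrite <- B at 1. rewrite <- fiter_add, Nat.add_comm, D, <- Nat.add_assoc, fiter_add.
  rewrite (Nat.add_comm j i), fiter_add, E, <- fiter_add, <- D. exact B.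
Qed.

Lemma continuity_eps h : continuity h -> forall e eps, 0 < eps ->
  exists delta, 0 < delta /\ forall y, Rabs (y - e) < delta -> Rabs (h y - h e) < eps.
Proof.
intros C e eps Heps. destruct (C e eps Heps) as [d [dp H]].
exists d. split; [exact dp|]. intros y yd.
destruct (Req_dec y e) as [->|ne].
- unfold Rminus. rewrite Rplus_opp_r, Rabs_R0. exact Heps.
- apply (H y). split; [split; [exact I | congruence] | exact yd].
Qed.

Lemma continuity_of_eps h :
  (forall e eps, 0 < eps ->
     exists delta, 0 < delta /\ forall y, Rabs (y - e) < delta -> Rabs (h y - h e) < eps) ->
  continuity h.
Proof.
intros H e eps Heps. destruct (H e eps Heps) as [d [dp K]].
exists d. split; [exact dp|]. intros y [_ yd]. exact (K y yd).
Qed.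

Lemma continuity_fiter F n : continuity F -> continuity (fiter n F).
Proof.
intro C. induction n as [|n IH].
- apply continuity_of_eps. intros e eps He. exists eps. simpl. now split.
- exact (continuity_comp (fiter n F) F IH C).
Qed.

(** The point is the supremum of the arguments with value at most [l]. Taking the last one is what
    bounds [h] below by [l] on all that follows, beyond the usual intermediate value theorem. *)
Lemma last_at_level h c d l : continuity h -> c <= d -> h c <= l <= h d ->
  exists e, c <= e <= d /\ h e = l /\ forall x, e <= x <= d -> l <= h x.
Proof.
intros C cd hl.
set (E := fun x => c <= x <= d /\ h x <= l).
destruct (completeness E) as [e [ub lub]].
{ exists d. intros x [[_ xd] _]. exact xd. }
{ exists c. split; lra. }
assert (ce : c <= e) by (apply ub; split; lra).
assert (ed : e <= d) by (apply lub; intros x [[_ xd] _]; exact xd).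
assert (above : forall x, e < x <= d -> l < h x).
{ intros x xr. destruct (Rlt_le_dec l (h x)) as [|k]; [assumption|].
  assert (x <= e) by (apply ub; split; lra). lra. }
assert (he1 : h e <= l).
{ destruct (Rle_lt_dec (h e) l) as [|k]; [assumption|].
  destruct (continuity_eps h C e (h e - l)) as [dl [dp H]]; [lra|].
  assert (e <= e - dl); [|lra].
  apply lub. intros x [xr hx]. assert (x <= e) by (apply ub; split; lra).
  destruct (Rle_lt_dec x (e - dl)) as [|k2]; [assumption|].
  specialize (H x). rewrite Rabs_left1 in H by lra.
  assert (K : Rabs (h x - h e) < h e - l) by (apply H; lra).
  apply Rabs_def2 in K. lra. }
assert (he2 : l <= h e).
{ destruct (Rle_lt_dec l (h e)) as [|k]; [assumption|].
  destruct (Req_dec e d) as [->|ned]; [lra|].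
  destruct (continuity_eps h C e (l - h e)) as [dl [dp H]]; [lra|].
  set (x := Rmin d (e + dl / 2)).
  assert (e < x) by (apply Rmin_glb_lt; lra).
  assert (x <= d) by apply Rmin_l.
  assert (x <= e + dl / 2) by apply Rmin_r.
  assert (A := above x). specialize (H x). rewrite Rabs_right in H by lra.
  assert (K : Rabs (h x - h e) < l - h e) by (apply H; lra).
  apply Rabs_def2 in K. lra. }
exists e. split; [lra|]. split; [lra|].
intros x xr. destruct (Req_dec x e) as [->|ne]; [lra|]. left. apply above. lra.
Qed.

Lemma continuity_neg h : continuity h -> continuity (fun x => - h x).
Proof. intro C. exact (continuity_opp h C). Qed.

Lemma continuity_mirror h : continuity h -> continuity (fun x => - h (- x)).
Proof.
intro C. apply continuity_neg.
apply (continuity_comp (fun x => - x) h); [|exact C].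
apply (continuity_neg (fun x => x)).
exact (derivable_continuous id derivable_id).
Qed.

Lemma subinterval_onto h c d l r : continuity h -> c <= d -> l <= r ->
  (h c <= l /\ r <= h d) \/ (h d <= l /\ r <= h c) ->
  exists c' d', c <= c' <= d' /\ d' <= d /\
    ((h c' = l /\ h d' = r) \/ (h c' = r /\ h d' = l)) /\
    forall x, c' <= x <= d' -> l <= h x <= r.
Proof.
assert (Inc : forall h l r, continuity h -> c <= d -> l <= r -> h c <= l /\ r <= h d ->
  exists c' d', c <= c' <= d' /\ d' <= d /\ h c' = l /\ h d' = r /\
    forall x, c' <= x <= d' -> l <= h x <= r).
{ clear h l r. intros h l r C cd lr [hc hd].
  (* In the mirror image, the last passage at [- r] gives a point with value [r] before which [h]
     stays at most [r]; the last passage at [l] before it then closes the interval. *)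
  destruct (last_at_level _ (- d) (- c) (- r) (continuity_mirror h C)) as [e [er [he above]]];
    [lra | rewrite !Ropp_involutive; lra |].
  destruct (last_at_level h c (- e) l C) as [c' [cr [hc' above']]]; [lra | lra |].
  exists c', (- e). repeat split; try lra.
  - apply above'. lra.
  - assert (- r <= - h (- - x)) by (apply above; lra).
    rewrite Ropp_involutive in H0. lra. }
intros C cd lr [H|H].
- destruct (Inc h l r C cd lr H) as [c' [d' K]]. exists c', d'. tauto.
- destruct (Inc (fun x => - h x) (- r) (- l)) as [c' [d' [K1 [K2 [K3 [K4 K5]]]]]];
    [now apply continuity_neg | lra | lra | lra |].
  exists c', d'. split; [lra|]. split; [lra|]. split; [right; lra|].
  intros x xr. specialize (K5 x xr). lra.
Qed.

(** This implies that F([a,b]) contains [a',b'], but it is decided by the endpoint values alone,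
    which are known on a cycle. *)
Definition spans (F : R -> R) (a b a' b' : R) : Prop :=
  (F a <= a' /\ b' <= F b) \/ (F b <= a' /\ b' <= F a).

(** The interval is shrunk step by step. The induction keeps the endpoints mapped exactly to the
    endpoints of the current interval of the walk, so that the next [spans] applies to them. *)
Lemma walk_interval F lo hi t : continuity F ->
  (forall i, (i <= t)%nat -> lo i <= hi i) ->
  (forall i, (i < t)%nat -> spans F (lo i) (hi i) (lo (S i)) (hi (S i))) ->
  exists c d, lo O <= c <= d /\ d <= hi O /\
    (forall x, c <= x <= d -> forall i, (i <= t)%nat -> lo i <= fiter i F x <= hi i) /\
    ((fiter t F c = lo t /\ fiter t F d = hi t) \/ (fiter t F c = hi t /\ fiter t F d = lo t)).
Proof.
intros C. induction t as [|t IH]; intros le sp.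
- exists (lo O), (hi O). specialize (le O (le_n _)). repeat split; try lra.
  + replace i with O by lia. simpl. lra.
  + replace i with O by lia. simpl. lra.
  + left. simpl. lra.
- destruct IH as [c [d [K1 [K2 [K3 K4]]]]]; [intros; apply le; lia | intros; apply sp; lia |].
  destruct (subinterval_onto (fiter (S t) F) c d (lo (S t)) (hi (S t)))
    as [c' [d' [L1 [L2 [L3 L4]]]]].
  + now apply continuity_fiter.
  + lra.
  + apply le. lia.
  + simpl. assert (S := sp t (Nat.lt_succ_diag_r t)). unfold spans in S.
    destruct K4 as [[-> ->]|[-> ->]]; tauto.
  + exists c', d'. split; [lra|]. split; [lra|]. split; [|exact L3].
    intros x xr i it. destruct (Nat.eq_dec i (S t)) as [->|ne].
    * now apply L4.
    * apply K3; [lra | lia].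
Qed.

(** The interval [c,d] inside the starting interval is sent onto the whole of it, endpoints to
    endpoints, so the [t]-th iterate minus the identity changes sign there. *)
Lemma loop_point F lo hi t : continuity F ->
  (forall i, (i <= t)%nat -> lo i <= hi i) ->
  (forall i, (i < t)%nat -> spans F (lo i) (hi i) (lo (S i)) (hi (S i))) ->
  lo t = lo O -> hi t = hi O ->
  exists x, fiter t F x = x /\ forall i, (i <= t)%nat -> lo i <= fiter i F x <= hi i.
Proof.
intros C le sp e1 e2.
destruct (walk_interval F lo hi t C le sp) as [c [d [K1 [K2 [K3 K4]]]]].
assert (Cg : continuity (fun x => fiter t F x - x)).
{ apply (continuity_minus (fiter t F) id); [now apply continuity_fiter|].
  exact (derivable_continuous id derivable_id). }
assert (Z : exists e, c <= e <= d /\ fiter t F e - e = 0).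
{ destruct K4 as [[E1 E2]|[E1 E2]].
  - destruct (last_at_level _ c d 0 Cg) as [e [er [he _]]]; [lra | lra |]. now exists e.
  - destruct (last_at_level _ c d 0 (continuity_neg _ Cg)) as [e [er [he _]]]; [lra | lra |].
    exists e. split; [exact er | lra]. }
destruct Z as [e [er he]]. exists e. split; [lra | now apply K3].
Qed.

(** * Hulls of the central gap *)

(** A discrete intermediate value theorem that also keeps the direction of the jump. *)
Lemma bool_switch (q : nat -> bool) a b : (a < b)%nat -> q a <> q b ->
  exists e, (a <= e < b)%nat /\ q e = q a /\ q (S e) = q b.
Proof.
intros ab. induction b as [|b IH]; [lia|]. intro ne.
destruct (Bool.bool_dec (q a) (q b)) as [E|E].
- exists b. split; [lia|]. split; [now symmetry | reflexivity].
- assert (a < b)%nat by (destruct (Nat.eq_dec a b); [congruence | lia]).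
  destruct (IH H E) as [e [er [e1 e2]]]. exists e. split; [lia|]. split; [exact e1|].
  rewrite e2. revert ne E. now destruct (q a), (q b), (q (S b)).
Qed.

Lemma bool_switch' (q : nat -> bool) a b : q a <> q b ->
  exists e, (Nat.min a b <= e < Nat.max a b)%nat /\ q e <> q (S e).
Proof.
intro ne. destruct (Nat.lt_total a b) as [l|[->|l]]; [|now contradiction ne|].
- destruct (bool_switch q a b l ne) as [e [er [e1 e2]]]. exists e. split; [lia | congruence].
- destruct (bool_switch q b a l) as [e [er [e1 e2]]]; [congruence|].
  exists e. split; [lia | congruence].
Qed.

(** This turns covering of interval [k] into a jump of the threshold test at [k], to which the
    discrete intermediate value theorem applies. *)
Lemma covers_switch s k e : Nat.leb (s e) k <> Nat.leb (s (S e)) k <-> covers s e k.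
Proof.
unfold covers. destruct (Nat.leb_spec (s e) k), (Nat.leb_spec (s (S e)) k);
  split; intro H'; try lia; congruence.
Qed.

Section Hull.
Variables (N m : nat) (s : nat -> nat).
Hypothesis s_range : forall i, (i < N)%nat -> (s i < N)%nat.
Hypothesis s_trans : forall i j, (i < N)%nat -> (j < N)%nat -> exists k, Nat.iter k s i = j.
Hypothesis m_range : (S m < N)%nat.
Hypothesis s_m : (m < s m)%nat.
Hypothesis s_Sm : (s (S m) <= m)%nat.

(** The range is [l, ..., l + d] inclusive, that is [d + 1] positions. *)
Fixpoint min_on l d : nat :=
  match d with O => s l | S d' => Nat.min (min_on l d') (s (l + S d')) end.
Fixpoint max_on l d : nat :=
  match d with O => s l | S d' => Nat.max (max_on l d') (s (l + S d')) end.

Lemma min_on_le l d k : (l <= k <= l + d)%nat -> (min_on l d <= s k)%nat.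
Proof.
induction d as [|d IH]; intro H; simpl; [replace k with l by lia; lia|].
destruct (Nat.eq_dec k (l + S d)) as [->|ne]; [lia|]. specialize (IH ltac:(lia)). lia.
Qed.

Lemma max_on_ge l d k : (l <= k <= l + d)%nat -> (s k <= max_on l d)%nat.
Proof.
induction d as [|d IH]; intro H; simpl; [replace k with l by lia; lia|].
destruct (Nat.eq_dec k (l + S d)) as [->|ne]; [lia|]. specialize (IH ltac:(lia)). lia.
Qed.

Lemma min_on_attained l d : exists k, (l <= k <= l + d)%nat /\ s k = min_on l d.
Proof.
induction d as [|d [k [kr E]]]; simpl; [exists l; split; lia|].
destruct (Nat.le_gt_cases (min_on l d) (s (l + S d))).
- exists k. split; lia.
- exists (l + S d)%nat. split; lia.
Qed.

Lemma max_on_attained l d : exists k, (l <= k <= l + d)%nat /\ s k = max_on l d.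
Proof.
induction d as [|d [k [kr E]]]; simpl; [exists l; split; lia|].
destruct (Nat.le_gt_cases (s (l + S d)) (max_on l d)).
- exists k. split; lia.
- exists (l + S d)%nat. split; lia.
Qed.

Fixpoint hull i : nat * nat :=
  match i with
  | O => (m, S m)
  | S i' => (min_on (fst (hull i')) (snd (hull i') - fst (hull i')),
             max_on (fst (hull i')) (snd (hull i') - fst (hull i')))
  end.

Definition lo i := fst (hull i).
Definition hi i := snd (hull i).

Lemma lo_S i : lo (S i) = min_on (lo i) (hi i - lo i).
Proof. reflexivity. Qed.

Lemma hi_S i : hi (S i) = max_on (lo i) (hi i - lo i).
Proof. reflexivity. Qed.

Lemma hull_image_from i k : (lo i <= m)%nat -> (m < hi i)%nat ->
  (lo i <= k <= hi i)%nat -> (lo (S i) <= s k <= hi (S i))%nat.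
Proof.
intros l h kr. rewrite lo_S, hi_S. split; [apply min_on_le | apply max_on_ge]; lia.
Qed.

(** The ends of the central gap change sides, so the first hull contains the gap; images of nested
    sets are nested. *)
Lemma hull_mono i : (lo (S i) <= lo i /\ lo i <= m /\ m < hi i /\ hi i <= hi (S i))%nat.
Proof.
induction i as [|i IH].
- assert (A := hull_image_from 0 m). assert (A' := hull_image_from 0 (S m)).
  change (lo 0) with m in *. change (hi 0) with (S m) in *. lia.
- destruct (min_on_attained (lo i) (hi i - lo i)) as [k [kr kE]].
  destruct (max_on_attained (lo i) (hi i - lo i)) as [k' [kr' kE']].
  rewrite <- lo_S in kE. rewrite <- hi_S in kE'.
  assert (A1 := hull_image_from (S i) k). assert (A2 := hull_image_from (S i) k'). lia.
Qed.

Lemma hull_image i k : (lo i <= k <= hi i)%nat -> (lo (S i) <= s k <= hi (S i))%nat.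
Proof. assert (M := hull_mono i). apply hull_image_from; lia. Qed.

Lemma hull_lo_attained i : exists k, (lo i <= k <= hi i)%nat /\ s k = lo (S i).
Proof.
destruct (min_on_attained (lo i) (hi i - lo i)) as [k [kr kE]].
assert (H := hull_mono i). exists k. split; [lia | exact kE].
Qed.

Lemma hull_hi_attained i : exists k, (lo i <= k <= hi i)%nat /\ s k = hi (S i).
Proof.
destruct (max_on_attained (lo i) (hi i - lo i)) as [k [kr kE]].
assert (H := hull_mono i). exists k. split; [lia | exact kE].
Qed.

Lemma hull_range i : (hi i < N)%nat.
Proof.
induction i as [|i IH]; [exact m_range|].
destruct (hull_hi_attained i) as [k [kr <-]]. apply s_range. lia.
Qed.

(** A hull that stops growing is invariant under [s], and by transitivity it then contains both
    extreme positions. *)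
Lemma hull_grow i : lo (S i) = lo i -> hi (S i) = hi i -> (lo i = 0 /\ S (hi i) = N)%nat.
Proof.
intros E1 E2. assert (H := hull_mono i). assert (HR := hull_range i).
assert (Inv : forall k, (lo i <= Nat.iter k s m <= hi i)%nat).
{ induction k as [|k IH]; simpl Nat.iter; [lia|].
  rewrite <- E1, <- E2. now apply hull_image. }
destruct (s_trans m 0) as [k kE]; [lia | lia |].
destruct (s_trans m (N - 1)) as [k' kE']; [lia | lia |].
assert (I1 := Inv k). assert (I2 := Inv k'). lia.
Qed.

(** The width grows by at least one per step until the hull is everything. The number [c] records a
    head start over the index; at the central gap it is 1. *)
Lemma hull_size_from i c k : (c + i <= hi i - lo i)%nat ->
  (c + (i + k) <= hi (i + k) - lo (i + k) \/ (lo (i + k) = 0 /\ S (hi (i + k)) = N))%nat.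
Proof.
intro H. induction k as [|k IH]; [rewrite Nat.add_0_r; now left|].
rewrite Nat.add_succ_r. assert (M := hull_mono (i + k)). assert (M' := hull_mono (S (i + k))).
assert (HR := hull_range (S (i + k))).
destruct IH as [IH|IH]; [|right; lia].
destruct (Nat.eq_dec (lo (S (i + k))) (lo (i + k))) as [E1|E1].
- destruct (Nat.eq_dec (hi (S (i + k))) (hi (i + k))) as [E2|E2].
  + assert (G := hull_grow _ E1 E2). right. lia.
  + left. lia.
- left. lia.
Qed.

Lemma hull_walk i k : (lo i <= k < hi i)%nat ->
  exists w, w O = m /\ w i = k /\ (forall j, (j < i)%nat -> covers s (w j) (w (S j))) /\
    forall j, (j <= i)%nat -> (S (w j) < N)%nat.
Proof.
revert k. induction i as [|i IH]; intros k kr.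
- exists (fun _ => m). change (lo 0) with m in kr. change (hi 0) with (S m) in kr. repeat split; intros; try lia.
- destruct (hull_lo_attained i) as [a [ar aE]]. destruct (hull_hi_attained i) as [b [br bE]].
  (* The positions [a] and [b] are sent to the two ends of the new hull, hence to both sides of
     interval [k]; some interval between them must cover it. *)
  destruct (bool_switch' (fun e => Nat.leb (s e) k) a b) as [e [er eS]].
  { rewrite aE, bE. destruct (Nat.leb_spec (lo (S i)) k), (Nat.leb_spec (hi (S i)) k); [lia | congruence | lia | lia]. }
  apply covers_switch in eS.
  destruct (IH e) as [w [w0 [wi [wc wr]]]]; [lia|].
  exists (fun j => if Nat.leb j i then w j else k).
  assert (HR := hull_range (S i)).
  split; [exact w0|]. split; [destruct (Nat.leb_spec (S i) i); [lia | reflexivity]|]. split.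
  + intros j ji. destruct (Nat.leb_spec j i), (Nat.leb_spec (S j) i); try lia.
    * now apply wc.
    * replace j with i by lia. rewrite wi. exact eS.
  + intros j ji. destruct (Nat.leb_spec j i); [now apply wr | lia].
Qed.

Definition switches k : Prop := (k <= m /\ m < s k)%nat \/ (m < k /\ s k <= m)%nat.

(** The end of the central gap on the side of [k] changes sides while [k] does not, so an interval
    between the two covers the gap. It differs from the gap because it lies on one side of it. *)
Lemma nonswitching_covers_center i k : (lo i <= k <= hi i)%nat -> ~ switches k ->
  exists e, (lo i <= e < hi i)%nat /\ e <> m /\ covers s e m.
Proof.
intros kr ns. assert (M := hull_mono i). unfold switches in ns.
set (q := fun e => Nat.leb (s e) m).
assert (qm : q m = false) by (apply Nat.leb_gt; lia).
assert (qSm : q (S m) = true) by (apply Nat.leb_le; lia).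
destruct (Nat.le_gt_cases k m).
- assert (qk : q k = true) by (apply Nat.leb_le; lia).
  destruct (bool_switch' q k m) as [e [er eS]]; [congruence|].
  exists e. split; [lia|]. split; [lia|]. now apply covers_switch.
- assert (qk : q k = false) by (apply Nat.leb_gt; lia).
  destruct (bool_switch' q (S m) k) as [e [er eS]]; [congruence|].
  exists e. split; [lia|]. split; [lia|]. now apply covers_switch.
Qed.

(** Position 0 is on the left and every step changes sides. *)
Lemma switching_odd_iterates : (forall k, (k < N)%nat -> switches k) ->
  forall j, (m < Nat.iter (2 * j + 1) s 0)%nat.
Proof.
intros all.
assert (A : forall j, (Nat.iter j s 0 < N)%nat).
{ induction j as [|j IH]; simpl; [lia|]. now apply s_range. }
induction j as [|j IH].
- assert (S0 := all O ltac:(lia)). unfold switches in S0. simpl. lia.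
- replace (2 * S j + 1)%nat with (S (S (2 * j + 1))) by lia. simpl Nat.iter.
  assert (S1 := all _ (A (2 * j + 1)%nat)). assert (S2 := all _ (A (S (2 * j + 1)))).
  unfold switches in S1, S2. simpl Nat.iter in *. lia.
Qed.

(* If every hull before the last one consists of switching points, each step adds exactly one
   point, which must be the image of the previously added one: the orbit spirals outwards. *)
Lemma spiral n : N = (2 * n + 1)%nat -> s m = S m ->
  (forall i k, (S (S i) <= 2 * n)%nat -> (lo i <= k <= hi i)%nat -> switches k) ->
  (exists k, (k < N)%nat /\ ~ switches k) ->
  forall i, (i < N)%nat -> s i = stefan n i.
Proof.
intros HN smE sw [z [zN zns]].
assert (notall : forall i, (S (S i) <= 2 * n)%nat -> ~ (lo i = 0 /\ S (hi i) = N)%nat).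
{ intros i il [h1 h2]. apply zns. apply (sw i); [exact il | lia]. }
(* Growth by two points at some step would make hull [2 n - 2] the whole cycle, and then the point
   [z] that keeps its side would have to switch. *)
assert (low : forall i, (i + 1 <= 2 * n)%nat -> (hi i - lo i = i + 1)%nat).
{ intros i il.
  destruct (hull_size_from 0 1 i) as [H|H]; [change (1 + 0 <= S m - m)%nat; lia | | ].
  - simpl Nat.add in H. destruct (Nat.eq_dec (hi i - lo i) (i + 1)) as [|ne]; [assumption|exfalso].
    assert (HR := hull_range i).
    assert (il2 : (i + 2 <= 2 * n)%nat) by lia.
    destruct (hull_size_from i 2 (2 * n - 2 - i)) as [K|K]; [lia | |].
    + replace (i + (2 * n - 2 - i))%nat with (2 * n - 2)%nat in K by lia.
      assert (HR' := hull_range (2 * n - 2)).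
      apply (notall (2 * n - 2)%nat); lia.
    + revert K. apply notall. lia.
  - simpl Nat.add in H. destruct (Nat.eq_dec (i + 1) (2 * n)) as [e|ne]; [lia|].
    exfalso. revert H. apply notall. lia. }
assert (claim : forall j, (j + 1 <= n)%nat ->
  (lo (2 * j) + j = m /\ hi (2 * j) = m + 1 + j /\
   lo (2 * j + 1) + j + 1 = m /\ hi (2 * j + 1) = m + 1 + j /\
   s (m + 1 + j) + j + 1 = m /\ s (m - j) = m + 1 + j)%nat).
{ induction j as [|j IH]; intro jn.
  - assert (L1 := low 1%nat ltac:(lia)). assert (M := hull_mono 0).
    assert (Image := hull_image 0).
    destruct (hull_lo_attained 0) as [a [ar aE]]. destruct (hull_hi_attained 0) as [b [br bE]].
    change (lo 0) with m in *. change (hi 0) with (S m) in *.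
    simpl Nat.mul. simpl Nat.add.
    change (lo 0) with m in *. change (hi 0) with (S m) in *.
    rewrite Nat.add_0_r, Nat.sub_0_r. replace (m + 1)%nat with (S m) by lia.
    assert (b = m \/ b = S m) by lia. assert (a = m \/ a = S m) by lia.
    assert (hi 1 = S m) by (destruct H; subst b; lia).
    assert (a = S m) by (destruct H0; subst a; lia).
    subst a. rewrite !Nat.add_0_r. lia.
  - destruct IH as [I1 [I2 [I3 [I4 [I5 I6]]]]]; [lia|].
    assert (L0 := low (2 * j + 1)%nat ltac:(lia)).
    assert (L1 := low (S (2 * j + 1)) ltac:(lia)).
    assert (L2 := low (S (S (2 * j + 1))) ltac:(lia)).
    assert (M1 := hull_mono (2 * j + 1)). assert (M2 := hull_mono (S (2 * j + 1))).
    assert (E0 : S (2 * j) = (2 * j + 1)%nat) by lia.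
    assert (Im0 := hull_image (2 * j)). rewrite E0 in Im0.
    assert (Im1 := hull_image (2 * j + 1)).
    (* Hull [2 j + 1] exceeds hull [2 j] only by the point [m - S j], so no other point can enlarge
       the next hull; since this point changes sides, it does so on the right. The next assertion is
       the same argument on the other side. *)
    assert (newlo : s (m - S j) = hi (S (2 * j + 1)) /\ lo (S (2 * j + 1)) = lo (2 * j + 1)).
    { assert (SW := sw (2 * j + 1)%nat (m - S j)%nat ltac:(lia) ltac:(lia)).
      unfold switches in SW.
      destruct (hull_lo_attained (2 * j + 1)) as [a [ar aE]].
      destruct (hull_hi_attained (2 * j + 1)) as [b [br bE]].
      assert (Ia := Im0 a). assert (Ib := Im0 b).
      destruct (Nat.eq_dec a (m - S j)) as [->|na], (Nat.eq_dec b (m - S j)) as [->|nb]; lia. }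
    destruct newlo as [N1 N2].
    assert (newhi : s (m + 2 + j) = lo (S (S (2 * j + 1)))
                    /\ hi (S (S (2 * j + 1))) = hi (S (2 * j + 1))).
    { assert (SW := sw (S (2 * j + 1)) (m + 2 + j)%nat ltac:(lia) ltac:(lia)).
      unfold switches in SW.
      destruct (hull_lo_attained (S (2 * j + 1))) as [a [ar aE]].
      destruct (hull_hi_attained (S (2 * j + 1))) as [b [br bE]].
      assert (Ia := Im1 a). assert (Ib := Im1 b).
      destruct (Nat.eq_dec a (m + 2 + j)) as [->|na], (Nat.eq_dec b (m + 2 + j)) as [->|nb]; lia. }
    destruct newhi as [N3 N4].
    replace (2 * S j)%nat with (S (2 * j + 1)) by lia.
    replace (S (2 * j + 1) + 1)%nat with (S (S (2 * j + 1))) by lia.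
    replace (m + 1 + S j)%nat with (m + 2 + j)%nat by lia. lia. }
assert (npos : (1 <= n)%nat) by lia.
(* Hull [2 n - 1] has width [2 n], so it is everything and its lower end [m - n] is 0. *)
assert (mn : m = n).
{ destruct (claim (n - 1)%nat ltac:(lia)) as [_ [_ [C3 [C4 _]]]].
  assert (L := low (2 * (n - 1) + 1)%nat ltac:(lia)).
  assert (HR := hull_range (2 * (n - 1) + 1)). lia. }
assert (high : forall i, (n < i < N)%nat -> s i = (2 * n - i)%nat).
{ intros i ir. destruct (claim (i - n - 1)%nat ltac:(lia)) as [_ [_ [_ [_ [C5 _]]]]].
  replace (m + 1 + (i - n - 1))%nat with i in C5 by lia. lia. }
assert (mid : forall i, (0 < i <= n)%nat -> s i = (2 * n + 1 - i)%nat).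
{ intros i ir. destruct (claim (n - i)%nat ltac:(lia)) as [_ [_ [_ [_ [_ C6]]]]].
  replace (m - (n - i))%nat with i in C6 by lia. lia. }
(* The images of all positions but 0 are known by now, and [n] is the value they leave out. *)
assert (zero : s 0 = n).
{ destruct (s_trans (S n) n) as [k kE]; [lia | lia |].
  destruct k as [|k]; [simpl in kE; lia|]. simpl in kE.
  assert (A : (Nat.iter k s (S n) < N)%nat).
  { clear kE. induction k as [|k IH]; simpl; [lia|]. now apply s_range. }
  set (y := Nat.iter k s (S n)) in *.
  destruct (Nat.eq_dec y 0) as [e|ne]; [now rewrite <- e|exfalso].
  destruct (Nat.le_gt_cases y n); [rewrite (mid y) in kE by lia | rewrite (high y) in kE by lia]; lia. }
intros i ir. unfold stefan. destruct (Nat.eqb_spec i 0) as [->|]; [exact zero|].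
destruct (Nat.leb_spec i n); [now apply mid; lia | now apply high; lia].
Qed.

End Hull.

(** * Cycles of real maps *)

Lemma sorted_enumeration N (x : nat -> R) :
  (forall i j, (i < N)%nat -> (j < N)%nat -> x i = x j -> i = j) ->
  exists p : nat -> R, (forall i j, (i < j < N)%nat -> p i < p j) /\
    (forall i, (i < N)%nat -> exists j, (j < N)%nat /\ p j = x i) /\
    (forall j, (j < N)%nat -> exists i, (i < N)%nat /\ p j = x i).
Proof.
induction N as [|N IH]; intro inj.
- exists x. repeat split; intros; lia.
- destruct IH as [p [P1 [P2 P3]]]; [intros; apply inj; try lia; assumption|].
  assert (sep : forall j, (j < N)%nat -> p j <> x N).
  { intros j jN E. destruct (P3 j jN) as [i [iN e]].
    assert (i = N) by (apply inj; [lia | lia | congruence]). lia. }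
  assert (K : exists k, (k <= N)%nat /\ (forall j, (j < k)%nat -> p j < x N) /\
                        (forall j, (k <= j < N)%nat -> x N < p j)).
  { clear P2 P3 inj. revert P1 sep. generalize (x N). intro z.
    induction N as [|N IH]; intros P1 sep.
    - exists O. repeat split; intros; lia.
    - destruct IH as [k [kN [K1 K2]]]; [intros; apply P1; lia | intros; apply sep; lia |].
      assert (sN := sep N (Nat.lt_succ_diag_r N)).
      destruct (Rlt_le_dec (p N) z) as [l|l].
      + exists (S N). split; [lia|]. split; [|intros; lia].
        intros j jN. destruct (Nat.eq_dec j N) as [->|]; [exact l|].
        assert (p j < p N) by (apply P1; lia). lra.
      + exists k. split; [lia|]. split; [exact K1|].
        intros j jN. destruct (Nat.eq_dec j N) as [->|]; [lra|]. apply K2. lia. }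
  destruct K as [k [kN [K1 K2]]].
  exists (fun j => if Nat.ltb j k then p j else if Nat.eqb j k then x N else p (j - 1)%nat).
  split; [|split].
  + intros i j ij.
    destruct (Nat.ltb_spec i k), (Nat.ltb_spec j k), (Nat.eqb_spec i k), (Nat.eqb_spec j k);
      subst; try lia; (apply P1; lia) || (apply K1; lia) || (apply K2; lia).
  + intros i iN. destruct (Nat.eq_dec i N) as [->|ne].
    * exists k. split; [lia|]. destruct (Nat.ltb_spec k k); [lia|]. now rewrite Nat.eqb_refl.
    * destruct (P2 i) as [j [jN E]]; [lia|]. destruct (Nat.lt_ge_cases j k).
      -- exists j. split; [lia|]. now destruct (Nat.ltb_spec j k); [|lia].
      -- exists (S j). split; [lia|].
         destruct (Nat.ltb_spec (S j) k), (Nat.eqb_spec (S j) k); try lia.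
         rewrite <- E. f_equal. lia.
  + intros j jN. destruct (Nat.ltb_spec j k), (Nat.eqb_spec j k); try lia.
    * destruct (P3 j) as [i [iN E]]; [lia|]. exists i. split; [lia | exact E].
    * exists N. split; [lia | reflexivity].
    * destruct (P3 (j - 1)%nat) as [i [iN E]]; [lia|]. exists i. split; [lia | exact E].
Qed.

(** The order type [s] is separated from the real points [p], so that hulls and walks can be treated
    on natural numbers. *)
Definition cycle_on (F : R -> R) (N : nat) (p : nat -> R) (s : nat -> nat) : Prop :=
  (forall i j, (i < j < N)%nat -> p i < p j) /\
  (forall i, (i < N)%nat -> (s i < N)%nat /\ F (p i) = p (s i)) /\
  (forall i j, (i < N)%nat -> (j < N)%nat -> exists k, Nat.iter k s i = j) /\
  (forall i, (i < N)%nat -> min_period F N (p i)).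

Lemma cycle_inj F N p s i j : cycle_on F N p s ->
  (i < N)%nat -> (j < N)%nat -> p i = p j -> i = j.
Proof.
intros [inc _] iN jN E. destruct (Nat.lt_total i j) as [l|[e|l]]; [|exact e|].
- assert (p i < p j) by (apply inc; lia). lra.
- assert (p j < p i) by (apply inc; lia). lra.
Qed.

Lemma cycle_le F N p s i j : cycle_on F N p s -> (i <= j < N)%nat -> p i <= p j.
Proof.
intros [inc _] H. destruct (Nat.eq_dec i j) as [->|ne]; [lra|]. left. apply inc. lia.
Qed.

Lemma cycle_iter F N p s k i : cycle_on F N p s -> (i < N)%nat ->
  (Nat.iter k s i < N)%nat /\ fiter k F (p i) = p (Nat.iter k s i).
Proof.
intros [_ [st _]] iN. induction k as [|k [IH1 IH2]]; simpl; [now split|].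
rewrite IH2. now apply st.
Qed.

Lemma cycle_exists F N x : min_period F N x -> exists p s, cycle_on F N p s.
Proof.
intros P. assert (P' := P). destruct P' as [N1 [Nx Nmin]].
destruct (sorted_enumeration N (fun i => fiter i F x)) as [p [P1 [P2 P3]]].
{ assert (W : forall i j, (i < j < N)%nat -> fiter i F x <> fiter j F x).
  { intros i j ij E. apply (Nmin (N - j + i)%nat); [lia|].
    rewrite fiter_add, E, <- fiter_add. now replace (N - j + j)%nat with N by lia. }
  intros i j iN jN E. destruct (Nat.lt_total i j) as [l|[e|l]]; [|exact e|].
  - contradiction (W i j (conj l jN)).
  - symmetry in E. contradiction (W j i (conj l iN)). }
assert (orb : forall k, exists j, (j < N)%nat /\ p j = fiter k F x).
{ intro k. destruct (P2 (k mod N)%nat) as [j [jN E]]; [apply Nat.mod_upper_bound; lia|].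
  exists j. split; [exact jN|]. rewrite E.
  rewrite (Nat.div_mod_eq k N) at 2. rewrite Nat.add_comm, fiter_add, Nat.mul_comm.
  now rewrite fiter_mul. }
(* The bound on [i] stands inside the existential, so that choice yields a function on all of
   [nat]. *)
assert (next : forall i, exists j, (i < N)%nat -> (j < N)%nat /\ F (p i) = p j).
{ intro i. destruct (Nat.lt_ge_cases i N) as [l|g]; [|exists O; lia].
  destruct (P3 i l) as [k [kN E]]. destruct (orb (S k)) as [j [jN E']].
  exists j. intros _. split; [exact jN|]. rewrite E, E'. reflexivity. }
set (s := fun i => proj1_sig (constructive_indefinite_description _ (next i))).
assert (sP : forall i, (i < N)%nat -> (s i < N)%nat /\ F (p i) = p (s i)).
{ intro i. unfold s. exact (proj2_sig (constructive_indefinite_description _ (next i))). }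
assert (pinj : forall i j, (i < N)%nat -> (j < N)%nat -> p i = p j -> i = j).
{ intros i j iN jN E. destruct (Nat.lt_total i j) as [l|[e|l]]; [|exact e|].
  - assert (p i < p j) by (apply P1; lia). lra.
  - assert (p j < p i) by (apply P1; lia). lra. }
assert (it : forall k i, (i < N)%nat -> (Nat.iter k s i < N)%nat /\ fiter k F (p i) = p (Nat.iter k s i)).
{ intros k i iN. induction k as [|k [IH1 IH2]]; simpl; [now split|].
  rewrite IH2. now apply sP. }
exists p, s. split; [exact P1|]. split; [exact sP|]. split.
- intros i j iN jN. destruct (P3 i iN) as [a [aN Ea]]. destruct (P3 j jN) as [b [bN Eb]].
  exists (N - a + b)%nat. destruct (it (N - a + b)%nat i iN) as [I1 I2].
  apply pinj; [exact I1 | exact jN |]. rewrite <- I2, Ea, Eb, <- fiter_add.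
  replace (N - a + b + a)%nat with (b + N)%nat by lia. now rewrite fiter_add, Nx.
- intros i iN. destruct (P3 i iN) as [a [aN ->]]. now apply min_period_iter.
Qed.

Lemma covers_spans F N p s i j : cycle_on F N p s -> (S i < N)%nat -> (S j < N)%nat ->
  covers s i j -> spans F (p i) (p (S i)) (p j) (p (S j)).
Proof.
intros C iN jN H. assert (C' := C). destruct C' as [_ [st _]].
destruct (st i) as [r1 e1]; [lia|]. destruct (st (S i)) as [r2 e2]; [lia|].
unfold spans. rewrite e1, e2.
destruct H as [H|H]; [left|right]; split; apply (cycle_le F N p s); try exact C; lia.
Qed.

Lemma no_fixed F N p s i : cycle_on F N p s -> (2 <= N)%nat -> (i < N)%nat -> s i <> i.
Proof.
intros [_ [st [_ mp]]] N2 iN E. destruct (mp i iN) as [_ [_ H]].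
apply (H 1%nat); [lia|]. simpl. destruct (st i iN) as [_ ->]. now rewrite E.
Qed.

(** The lowest position moves up and the highest moves down; the gap sits where the direction
    changes. *)
Lemma center_exists F N p s : cycle_on F N p s -> (2 <= N)%nat ->
  exists m, (S m < N)%nat /\ (m < s m)%nat /\ (s (S m) <= m)%nat.
Proof.
intros C N2. assert (nf := no_fixed F N p s). destruct C as [C1 [st C2]].
destruct (bool_switch (fun i => Nat.ltb i (s i)) 0 (N - 1)) as [m [mr [m1 m2]]].
- lia.
- assert (F0 := nf O). assert (F1 := nf (N - 1)%nat).
  destruct (st (N - 1)%nat) as [r _]; [lia|].
  destruct (Nat.ltb_spec 0 (s 0%nat)), (Nat.ltb_spec (N - 1) (s (N - 1)%nat)); try congruence; try lia.
  exfalso. apply F0; [split; tauto | lia | lia | lia].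
- assert (F0 := nf O). assert (F1 := nf (N - 1)%nat). assert (F2 := nf (S m)).
  destruct (st (N - 1)%nat) as [r _]; [lia|].
  destruct (Nat.ltb_spec 0 (s 0%nat)).
  2: { exfalso. apply F0; [split; tauto | lia | lia | lia]. }
  destruct (Nat.ltb_spec (N - 1) (s (N - 1)%nat)); [lia|].
  apply Nat.ltb_lt in m1. apply Nat.ltb_ge in m2.
  assert (s (S m) <> S m) by (apply F2; [split; tauto | lia | lia]).
  exists m. lia.
Qed.

Lemma divide_odd d r : Nat.divide d r -> Nat.Odd r -> Nat.Odd d.
Proof.
intros [q E] O. destruct (Nat.Even_or_Odd d) as [[z Z]|]; [|assumption].
destruct O as [y Y]. nia.
Qed.

(** A walk of length [i] leads from the central gap to an interval [e] that covers the gap. This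
    closes up after [i + 1] steps, or after [i + 2] since the gap covers itself, and one of these
    lengths is odd. The period found divides that length. *)
Lemma nonswitching_odd_period F N p s m i k : continuity F -> cycle_on F N p s ->
  (S m < N)%nat -> (m < s m)%nat -> (s (S m) <= m)%nat ->
  (lo m s i <= k <= hi m s i)%nat -> ~ switches m s k ->
  exists d x, Nat.Odd d /\ (1 < d <= i + 2)%nat /\ min_period F d x.
Proof.
intros cF C mN s1 s2 kr ns. assert (C' := C). destruct C' as [_ [st [tr _]]].
assert (sr : forall i, (i < N)%nat -> (s i < N)%nat) by (intros; now apply st).
destruct (nonswitching_covers_center N m s mN s1 s2 i k kr ns) as [e [er [em ec]]].
destruct (hull_walk N m s sr mN s1 s2 i e er) as [w [w0 [wi [wc wr]]]].
assert (R : exists r, Nat.Odd r /\ (i + 1 <= r <= i + 2)%nat /\ (1 <= i)%nat).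
{ assert (1 <= i)%nat. { destruct i; [rewrite w0 in wi; congruence | lia]. }
  destruct (Nat.Even_or_Odd (i + 1)) as [E|O]; [|exists (i + 1)%nat; split; [exact O | lia]].
  exists (i + 2)%nat. split; [|lia]. destruct E as [z Z]. exists z. lia. }
destruct R as [r [rO [rr i1]]].
set (v := fun j => if Nat.leb j i then w j else m).
assert (vN : forall j, (S (v j) < N)%nat).
{ intro j. unfold v. destruct (Nat.leb_spec j i); [now apply wr | exact mN]. }
assert (vc : forall j, covers s (v j) (v (S j))).
{ intro j. unfold v. destruct (Nat.leb_spec j i), (Nat.leb_spec (S j) i); try lia.
  - apply wc. lia.
  - replace j with i by lia. now rewrite wi.
  - unfold covers. lia. }
destruct (loop_point F (fun j => p (v j)) (fun j => p (S (v j))) r cF) as [x [rx xr]].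
- intros j _. assert (V := vN j). apply (cycle_le F N p s _ _ C). lia.
- intros j _. now apply (covers_spans F N p s).
- cbv beta. change (v 0%nat) with (w 0%nat). rewrite w0.
  unfold v. destruct (Nat.leb_spec r i); [lia | reflexivity].
- cbv beta. change (v 0%nat) with (w 0%nat). rewrite w0.
  unfold v. destruct (Nat.leb_spec r i); [lia | reflexivity].
- destruct (min_period_exists F r x) as [d [dP dr]]; [lia | exact rx |].
  assert (dO := divide_odd d r dr rO).
  assert (dle : (d <= r)%nat) by (apply Nat.divide_pos_le; [lia | exact dr]).
  exists d, x. split; [exact dO|]. split; [|exact dP]. split; [|lia].
  destruct (Nat.eq_dec d 1) as [->|]; [exfalso | destruct dO; lia].
  assert (fx : F x = x) by (destruct dP as [_ [H _]]; exact H).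
  assert (x0 := xr 0%nat ltac:(lia)). assert (xi := xr i ltac:(lia)).
  assert (fi : fiter i F x = x).
  { clear - fx. induction i as [|i IH]; simpl; [reflexivity | now rewrite IH]. }
  rewrite fi in xi. simpl in x0.
  assert (v0 : v 0%nat = m) by exact w0.
  assert (vi : v i = e) by (unfold v; now rewrite Nat.leb_refl).
  rewrite v0 in x0. rewrite vi in xi.
  assert (eN := vN i). rewrite vi in eN.
  (* A fixed point would lie both in the central gap and in the different interval [e], so it would
     be a common endpoint; but no point of the cycle is fixed. *)
  assert (X : x = p m \/ x = p (S m)).
  { destruct (Nat.lt_total e m) as [l|[l|l]]; [|congruence|].
    - assert (p (S e) <= p m) by (apply (cycle_le F N p s _ _ C); lia). left. lra.
    - assert (p (S m) <= p e) by (apply (cycle_le F N p s _ _ C); lia). right. lra. }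
  assert (fxp : forall y, (y < N)%nat -> x <> p y).
  { intros y yN E. apply (no_fixed F N p s y C); [lia | exact yN |].
    apply (cycle_inj F N p s _ _ C); [now apply st | exact yN |].
    destruct (st y yN) as [_ <-]. rewrite <- E. exact fx. }
  destruct X as [X|X]; revert X; apply fxp; lia.
Qed.

(** Otherwise the iterate of 0 of order [2 n + 1] would lie to the right of the gap, although it is
    0. *)
Lemma odd_cycle_has_nonswitching F n p s m : cycle_on F (2 * n + 1) p s ->
  (S m < 2 * n + 1)%nat -> (m < s m)%nat -> (s (S m) <= m)%nat ->
  exists k, (k < 2 * n + 1)%nat /\ ~ switches m s k.
Proof.
intros C mN s1 s2. apply NNPP. intro H.
assert (all : forall k, (k < 2 * n + 1)%nat -> switches m s k).
{ intros k kN. apply NNPP. intro K. apply H. now exists k. }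
assert (C' := C). destruct C' as [_ [st [_ mp]]].
assert (sr : forall i, (i < 2 * n + 1)%nat -> (s i < 2 * n + 1)%nat) by (intros; now apply st).
assert (K := switching_odd_iterates (2 * n + 1) m s sr mN s1 s2 all n).
destruct (cycle_iter F _ p s (2 * n + 1) 0 C) as [I1 I2]; [lia|].
destruct (mp 0%nat) as [_ [P0 _]]; [lia|].
rewrite P0 in I2. apply (cycle_inj F _ p s _ _ C) in I2; [lia | lia | exact I1].
Qed.

Lemma minimal_odd_cycle F n p s m : continuity F -> (1 <= n)%nat ->
  cycle_on F (2 * n + 1) p s ->
  (forall d x, Nat.Odd d -> (1 < d < 2 * n + 1)%nat -> ~ min_period F d x) ->
  (S m < 2 * n + 1)%nat -> (m < s m)%nat -> (s (S m) <= m)%nat -> s m = S m ->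
  forall i, (i < 2 * n + 1)%nat -> s i = stefan n i.
Proof.
intros cF n1 C no mN s1 s2 smE.
assert (C' := C). destruct C' as [_ [st [tr _]]].
assert (sr : forall i, (i < 2 * n + 1)%nat -> (s i < 2 * n + 1)%nat) by (intros; now apply st).
apply (spiral (2 * n + 1) m s sr tr mN s1 s2 n eq_refl smE).
- intros i k il kr. apply NNPP. intro ns.
  destruct (nonswitching_odd_period F _ p s m i k cF C mN s1 s2 kr ns) as [d [x [dO [dr dP]]]].
  apply (no d x dO); [lia | exact dP].
- exact (odd_cycle_has_nonswitching F n p s m C mN s1 s2).
Qed.

(** Hull [N] is the whole cycle, so any point that kept its side would yield an odd period above
    1. *)
Lemma no_odd_period_all_switch F N p s : continuity F -> (2 <= N)%nat -> cycle_on F N p s ->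
  (forall d x, Nat.Odd d -> (1 < d)%nat -> ~ min_period F d x) ->
  exists m, (S m < N)%nat /\ forall k, (k < N)%nat -> switches m s k.
Proof.
intros cF N2 C no. destruct (center_exists F N p s C N2) as [m [mN [s1 s2]]].
exists m. split; [exact mN|]. intros k kN. apply NNPP. intro ns.
assert (C' := C). destruct C' as [_ [st [tr _]]].
assert (sr : forall i, (i < N)%nat -> (s i < N)%nat) by (intros; now apply st).
assert (whole : (lo m s N <= k <= hi m s N)%nat).
{ assert (HR := hull_range N m s sr mN s1 s2 N).
  destruct (hull_size_from N m s sr tr mN s1 s2 0 0 N) as [H|H]; simpl Nat.add in *; lia. }
destruct (nonswitching_odd_period F N p s m N k cF C mN s1 s2 whole ns) as [d [x [dO [dr dP]]]].
apply (no d x dO); [lia | exact dP].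
Qed.

(** * Orbits forced by Stefan's cycle *)

(* The same statement outside the module, where <=, + and * on nat are the standard library's. *)
Lemma primitive_loops n t : (1 <= n)%nat -> (1 <= t)%nat ->
  exists L : list (nat -> nat),
    (forall w, In w L -> itinerary n t w /\ aperiodic t w) /\
    (forall i j d, (i < length L)%nat -> (j < length L)%nat -> i <> j ->
       exists k, nth i L (fun x => x) (k + d)%nat <> nth j L (fun x => x) k) /\
    (forall w, itinerary n t w -> aperiodic t w ->
       exists v d, In v L /\ (forall k, w (k + d)%nat = v k)) /\
    Z.of_nat (length L * t) = Phi n t.
Proof. exact (@Necklaces.necklaces n t). Qed.

Lemma stefan_cases n i : (i <= 2 * n)%nat ->
  (i = 0 /\ stefan n i = n)%nat \/ (0 < i <= n /\ stefan n i = 2 * n + 1 - i)%nat \/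
  (n < i /\ stefan n i = 2 * n - i)%nat.
Proof.
intro H. unfold stefan.
destruct (Nat.eqb_spec i 0); [left; lia|]. destruct (Nat.leb_spec i n); right; lia.
Qed.

Lemma stefan_range n i : (i <= 2 * n)%nat -> (stefan n i <= 2 * n)%nat.
Proof. intro H. destruct (stefan_cases n i H) as [|[|]]; lia. Qed.

Lemma stefan_iter_range n k i : (i <= 2 * n)%nat -> (Nat.iter k (stefan n) i <= 2 * n)%nat.
Proof. intro H. induction k as [|k IH]; [exact H | now apply stefan_range]. Qed.

Lemma iter_S {A} (f : A -> A) k x : Nat.iter (S k) f x = f (Nat.iter k f x).
Proof. reflexivity. Qed.

(** From the centre the cycle reads n, n+1, n-1, n+2, n-2, ..., 2n, 0. *)
Lemma stefan_iter_center n j : (j <= n)%nat ->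
  Nat.iter (2 * j) (stefan n) n = (n - j)%nat /\
  ((j < n)%nat -> Nat.iter (2 * j + 1) (stefan n) n = (n + 1 + j)%nat).
Proof.
induction j as [|j IH]; intro H.
- split; [simpl; lia|]. intro n0. simpl.
  destruct (stefan_cases n n) as [|[|]]; lia.
- destruct IH as [_ IH]; [lia|]. specialize (IH ltac:(lia)).
  assert (E : Nat.iter (2 * S j) (stefan n) n = (n - S j)%nat).
  { replace (2 * S j)%nat with (S (2 * j + 1)) by lia. rewrite iter_S, IH.
    destruct (stefan_cases n (n + 1 + j)) as [|[|]]; lia. }
  split; [exact E|]. intro jn.
  replace (2 * S j + 1)%nat with (S (2 * S j)) by lia. rewrite iter_S, E.
  destruct (stefan_cases n (n - S j)) as [|[|]]; lia.
Qed.

Lemma iter_add {A} (f : A -> A) a b x : Nat.iter (a + b) f x = Nat.iter a f (Nat.iter b f x).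
Proof. induction a as [|a IH]; simpl; [reflexivity | now rewrite IH]. Qed.

Lemma stefan_reach n y : (y <= 2 * n)%nat ->
  exists k, (k <= 2 * n)%nat /\ Nat.iter k (stefan n) n = y.
Proof.
intro H. destruct (Nat.le_gt_cases y n).
- exists (2 * (n - y))%nat. split; [lia|].
  destruct (stefan_iter_center n (n - y)) as [-> _]; lia.
- exists (2 * (y - n - 1) + 1)%nat. split; [lia|].
  destruct (stefan_iter_center n (y - n - 1)) as [_ ->]; lia.
Qed.

Lemma stefan_iter_period n y : (y <= 2 * n)%nat -> Nat.iter (2 * n + 1) (stefan n) y = y.
Proof.
intro H. destruct (stefan_reach n y H) as [k [_ <-]].
rewrite <- iter_add, Nat.add_comm, iter_add. f_equal.
replace (2 * n + 1)%nat with (S (2 * n)) by lia.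
destruct (stefan_iter_center n n (le_n n)) as [E _]. rewrite iter_S, E.
destruct (stefan_cases n (n - n)) as [|[|]]; lia.
Qed.

Lemma stefan_iter_neq n t y : (y <= 2 * n)%nat -> (0 < t < 2 * n + 1)%nat ->
  Nat.iter t (stefan n) y <> y.
Proof.
intros H tr E. destruct (stefan_reach n y H) as [k [kr kE]].
assert (E' : Nat.iter t (stefan n) n = n).
{ assert (back : Nat.iter (2 * n + 1 - k) (stefan n) y = n).
  { rewrite <- kE, <- iter_add. replace (2 * n + 1 - k + k)%nat with (2 * n + 1)%nat by lia.
    apply stefan_iter_period. lia. }
  apply (f_equal (Nat.iter (2 * n + 1 - k) (stefan n))) in E.
  rewrite <- iter_add, Nat.add_comm, iter_add, !back in E. exact E. }
destruct (Nat.Even_or_Odd t) as [[j J]|[j J]]; subst t.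
- destruct (stefan_iter_center n j) as [K _]; [lia|]. lia.
- destruct (stefan_iter_center n j) as [_ K]; [lia|]. lia.
Qed.

Lemma stefan_reach_zero n y : (y <= 2 * n)%nat -> exists j, Nat.iter j (stefan n) y = 0%nat.
Proof.
intro H. destruct (stefan_reach n y H) as [k [kr <-]]. exists (2 * n - k)%nat.
rewrite <- iter_add. replace (2 * n - k + k)%nat with (2 * n)%nat by lia.
destruct (stefan_iter_center n n (le_n n)) as [-> _]. lia.
Qed.

Definition stefan_cycle (F : R -> R) (n : nat) (p : nat -> R) : Prop :=
  (forall i j, (i < j <= 2 * n)%nat -> p i < p j) /\
  (forall i, (i <= 2 * n)%nat -> F (p i) = p (stefan n i)).

Definition follows (F : R -> R) (p : nat -> R) (w : nat -> nat) (x : R) : Prop :=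
  forall i, p (w i) <= fiter i F x <= p (S (w i)).

Section StefanCycle.
Variables (F : R -> R) (n : nat) (p : nat -> R).
Hypothesis C : stefan_cycle F n p.

Lemma stefan_cycle_iter k y : (y <= 2 * n)%nat -> fiter k F (p y) = p (Nat.iter k (stefan n) y).
Proof.
intro H. induction k as [|k IH]; [reflexivity|]. simpl. rewrite IH.
apply (proj2 C). now apply stefan_iter_range.
Qed.

Lemma stefan_p_le i j : (i <= 2 * n)%nat -> (j <= 2 * n)%nat -> p i <= p j -> (i <= j)%nat.
Proof.
intros hi hj le. destruct (Nat.le_gt_cases i j) as [|g]; [assumption|].
assert (p j < p i) by (apply (proj1 C); lia). lra.
Qed.

Lemma stefan_p_min_period y : (y <= 2 * n)%nat -> min_period F (2 * n + 1) (p y).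
Proof.
intro H. split; [lia|]. split.
- rewrite stefan_cycle_iter, stefan_iter_period; trivial.
- intros j jr E. rewrite stefan_cycle_iter in E by exact H.
  apply (stefan_iter_neq n j y H jr).
  assert (R := stefan_iter_range n j y H).
  apply Nat.le_antisymm; apply stefan_p_le; trivial; lra.
Qed.

(* At a point of the cycle the interval visited next is determined by the current one, and the
   leftmost point of the cycle lies in a single interval; so an itinerary through the cycle
   repeats with period 2n+1. *)
Lemma itinerary_through_cycle t w x i0 y0 : (1 <= t)%nat -> itinerary n t w -> follows F p w x ->
  (y0 <= 2 * n)%nat -> fiter i0 F x = p y0 -> forall i, w (i + (2 * n + 1))%nat = w i.
Proof.
intros t1 [wc wp] fo y0r E0.
set (y := fun j => Nat.iter j (stefan n) y0).
assert (yr : forall j, (y j <= 2 * n)%nat) by (intro j; now apply stefan_iter_range).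
assert (yS : forall j, y (S j) = stefan n (y j)) by reflexivity.
assert (fy : forall j, fiter (j + i0) F x = p (y j)).
{ intro j. rewrite fiter_add, E0. now apply stefan_cycle_iter. }
assert (wy : forall j, (w (j + i0) <= y j <= S (w (j + i0)))%nat).
{ intro j. destruct (wc (j + i0)%nat) as [wr _]. assert (f := fo (j + i0)%nat).
  rewrite fy in f. split; apply stefan_p_le; trivial; try lia; lra. }
(* At the leftmost point interval 0 is the only choice, so [w] and its shift by [2 n + 1] agree at
   time [j0]; [det] carries the agreement forward. *)
destruct (stefan_reach_zero n y0 y0r) as [j0 j0E]. fold (y j0) in j0E.
assert (per : forall j, y (j + (2 * n + 1))%nat = y j).
{ intro j. unfold y. rewrite iter_add. now rewrite stefan_iter_period. }
assert (det : forall k, w (k + j0 + i0)%nat = w (k + j0 + (2 * n + 1) + i0)%nat).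
{ clear E0. remember (2 * n + 1)%nat as M eqn:HM. induction k as [|k IH].
  - change (w (j0 + i0) = w (j0 + M + i0))%nat. assert (A := wy j0). assert (B := wy (j0 + M)%nat). rewrite per in B. lia.
  - assert (A := wy (k + j0)%nat). assert (B := wy (k + j0 + M)%nat).
    assert (A' := wy (S (k + j0))). assert (B' := wy (S (k + j0 + M))).
    rewrite yS in A', B'. rewrite per in B, B'.
    change (w (S (k + j0 + i0)) = w (S (k + j0 + M + i0)))%nat.
    change (S (k + j0) + i0)%nat with (S (k + j0 + i0)) in A'.
    change (S (k + j0 + M) + i0)%nat with (S (k + j0 + M + i0)) in B'.
    rewrite <- IH in B.
    destruct (wc (k + j0 + i0)%nat) as [wr c1].
    destruct (wc (k + j0 + M + i0)%nat) as [_ c2].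
    rewrite <- IH in c2. unfold covers in c1, c2.
    assert (H : (y (k + j0) = w (k + j0 + i0) \/ y (k + j0) = S (w (k + j0 + i0)))%nat) by lia.
    destruct H as [H|H]; rewrite H in *; lia. }
assert (wt : forall q i, w (i + q * t)%nat = w i).
{ induction q as [|q IH]; intro i; [f_equal; lia|].
  replace (i + S q * t)%nat with (i + q * t + t)%nat by lia. now rewrite wp. }
(* A multiple of the period [t] moves any index beyond [j0 + i0]. *)
intro i. rewrite <- (wt (j0 + i0)%nat i), <- (wt (j0 + i0)%nat (i + (2 * n + 1))%nat).
assert (j0 + i0 <= (j0 + i0) * t)%nat by nia.
replace (i + (j0 + i0) * t)%nat with (i + ((j0 + i0) * t - (j0 + i0)) + j0 + i0)%nat by lia.
rewrite det. f_equal. lia.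
Qed.

(** Touching an endpoint puts the orbit on the cycle, so [2 n + 1] divides [t] and is also a period
    of [w]; being different from [t], it contradicts aperiodicity. *)
Lemma follows_interior t w x : (1 <= t)%nat -> (t <> 2 * n + 1)%nat ->
  itinerary n t w -> aperiodic t w ->
  fiter t F x = x -> follows F p w x ->
  forall i, p (w i) < fiter i F x < p (S (w i)).
Proof.
intros t1 tn it ap tx fo.
assert (off : forall i y, (y <= 2 * n)%nat -> fiter i F x <> p y).
{ intros i y yr E.
  assert (D : Nat.divide (2 * n + 1) t).
  { apply (min_period_divide F _ _ (p y)); [now apply stefan_p_min_period|].
    rewrite <- E, <- fiter_add, Nat.add_comm, fiter_add, tx. reflexivity. }
  apply Nat.divide_pos_le in D; [|lia].
  destruct (ap (2 * n + 1)%nat) as [j jE]; [lia|].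
  apply jE. now apply (itinerary_through_cycle t w x i y). }
intro i. assert (f := fo i). destruct it as [wc _]. destruct (wc i) as [wr _].
assert (o1 := off i (w i)). assert (o2 := off i (S (w i))).
assert (p (w i) <> fiter i F x) by (intro Z; apply o1; [lia | now symmetry]).
assert (p (S (w i)) <> fiter i F x) by (intro Z; apply o2; [lia | now symmetry]).
lra.
Qed.

Lemma interior_unique i j z : (i < 2 * n)%nat -> (j < 2 * n)%nat ->
  p i < z < p (S i) -> p j < z < p (S j) -> i = j.
Proof.
intros hi hj zi zj.
assert (i < S j)%nat. { destruct (Nat.lt_ge_cases i (S j)) as [|g]; [assumption|].
  destruct (Nat.eq_dec i (S j)) as [->|]; [lra|].
  assert (p (S j) < p i) by (apply (proj1 C); lia). lra. }
assert (j < S i)%nat. { destruct (Nat.lt_ge_cases j (S i)) as [|g]; [assumption|].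
  destruct (Nat.eq_dec j (S i)) as [->|]; [lra|].
  assert (p (S i) < p j) by (apply (proj1 C); lia). lra. }
lia.
Qed.

Lemma follows_exists t w : continuity F -> (1 <= t)%nat -> itinerary n t w ->
  exists x, fiter t F x = x /\ follows F p w x.
Proof.
intros cF t1 [wc wp].
destruct (loop_point F (fun j => p (w j)) (fun j => p (S (w j))) t cF) as [x [tx xr]].
- intros i _. left. apply (proj1 C). destruct (wc i). lia.
- intros i _. destruct (wc i) as [r1 c]. destruct (wc (S i)) as [r2 _].
  unfold spans. rewrite !(proj2 C) by lia.
  assert (le : forall a b, (a <= b <= 2 * n)%nat -> p a <= p b).
  { intros a b ab. destruct (Nat.eq_dec a b) as [->|]; [lra|]. left. apply (proj1 C). lia. }
  assert (R1 := stefan_range n (w i)). assert (R2 := stefan_range n (S (w i))).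
  destruct c as [c|c]; [left|right]; split; apply le; lia.
- now rewrite <- (wp 0%nat).
- now rewrite <- (wp 0%nat).
- exists x. split; [exact tx|]. intro i.
  assert (wt : forall q i, w (i + q * t)%nat = w i).
  { induction q as [|q IH]; intro j; [f_equal; lia|].
    replace (j + S q * t)%nat with (j + q * t + t)%nat by lia. now rewrite wp. }
  assert (E : i = (i mod t + (i / t) * t)%nat) by (assert (H := Nat.div_mod_eq i t); lia).
  rewrite E, wt, fiter_add, fiter_mul by exact tx. apply xr.
  apply Nat.lt_le_incl, Nat.mod_upper_bound. lia.
Qed.

(** Open intervals are disjoint, so an earlier return of [x] would be a period of its itinerary. *)
Lemma follows_min_period t w x : (1 <= t)%nat -> (t <> 2 * n + 1)%nat ->
  itinerary n t w -> aperiodic t w -> fiter t F x = x -> follows F p w x -> min_period F t x.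
Proof.
intros t1 tn it ap tx fo. split; [exact t1|]. split; [exact tx|].
intros d dr E. destruct (ap d dr) as [i ne]. apply ne.
assert (I := follows_interior t w x t1 tn it ap tx fo).
destruct it as [wc _].
apply (interior_unique _ _ (fiter i F x)); [apply wc | apply wc | | apply I].
rewrite <- E at 1 2. rewrite <- fiter_add. apply I.
Qed.

(** The third clause, on arbitrary aperiodic itineraries, is there for sharpness: it shows that the
    listed orbits realise every itinerary up to a shift. *)
Lemma stefan_cycle_orbits t : continuity F -> (1 <= n)%nat -> (1 <= t)%nat -> (t <> 2 * n + 1)%nat ->
  exists L : list R,
    (forall x, In x L -> p 0%nat <= x <= p (2 * n)%nat /\ min_period F t x) /\
    (forall i j, (i < length L)%nat -> (j < length L)%nat -> i <> j ->
       ~ same_orbit F (nth i L 0) (nth j L 0)) /\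
    (forall w, itinerary n t w -> aperiodic t w ->
       exists x d, In x L /\ follows F p (fun i => w (i + d)%nat) x) /\
    Z.of_nat (length L * t) = Phi n t.
Proof.
intros cF n1 t1 tn.
destruct (primitive_loops n t n1 t1) as [W [W1 [W2 [W3 W4]]]].
set (pt := fun w => epsilon (inhabits 0) (fun x => fiter t F x = x /\ follows F p w x)).
assert (ptP : forall w, In w W -> fiter t F (pt w) = pt w /\ follows F p w (pt w)).
{ intros w wW. apply epsilon_spec. apply follows_exists; trivial. now apply W1. }
exists (map pt W). split; [|split; [|split]].
- intros x xL. apply in_map_iff in xL. destruct xL as [w [<- wW]].
  destruct (ptP w wW) as [tw fw]. destruct (W1 w wW) as [iw aw].
  split; [|now apply (follows_min_period t w)].
  assert (I := follows_interior t w _ t1 tn iw aw tw fw 0%nat). simpl in I.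
  destruct iw as [wc _]. destruct (wc 0%nat) as [wr _].
  assert (le : forall a b, (a <= b <= 2 * n)%nat -> p a <= p b).
  { intros a b ab. destruct (Nat.eq_dec a b) as [->|]; [lra|]. left. apply (proj1 C). lia. }
  assert (p 0%nat <= p (w 0%nat)) by (apply le; lia).
  assert (p (S (w 0%nat)) <= p (2 * n)%nat) by (apply le; lia). lra.
- rewrite length_map. intros i j il jl ij [d dE].
  destruct (W2 i j d il jl ij) as [k ne]. apply ne.
  set (u := nth i W (fun x => x)) in *. set (v := nth j W (fun x => x)) in *.
  assert (uW : In u W) by now apply nth_In. assert (vW : In v W) by now apply nth_In.
  rewrite (nth_indep _ 0 (pt (fun x => x))), map_nth in dE by now rewrite length_map.
  rewrite (nth_indep _ 0 (pt (fun x => x))), map_nth in dE by now rewrite length_map.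
  fold u v in dE.
  destruct (ptP u uW) as [tu fu]. destruct (ptP v vW) as [tv fv].
  destruct (W1 u uW) as [iu au]. destruct (W1 v vW) as [iv av].
  assert (Iu := follows_interior t u _ t1 tn iu au tu fu).
  assert (Iv := follows_interior t v _ t1 tn iv av tv fv).
  apply (interior_unique _ _ (fiter k F (pt v))); [apply iu | apply iv | | apply Iv].
  rewrite <- dE, <- fiter_add. apply Iu.
- intros w iw aw. destruct (W3 w iw aw) as [v [d [vW vE]]].
  exists (pt v), d. split; [now apply in_map|].
  destruct (ptP v vW) as [_ fv]. intro i. cbv beta.
  replace (w (i + d)%nat) with (v i) by (symmetry; apply vE). apply fv.
- rewrite length_map. exact W4.
Qed.

End StefanCycle.

(** * Forced orbits of period 2^k t *)

(** [distinct_orbits] without the interval: the maps here act on the whole line, and halving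
    replaces the interval by another one. *)
Definition orbit_family (F : R -> R) (t : nat) (L : list R) : Prop :=
  (forall x, In x L -> min_period F t x) /\
  (forall i j, (i < length L)%nat -> (j < length L)%nat -> i <> j ->
     ~ same_orbit F (nth i L 0) (nth j L 0)).

Lemma fiter_mirror F m x : fiter m (fun x => - F (- x)) x = - fiter m F (- x).
Proof. induction m as [|m IH]; simpl; [lra|]. now rewrite IH, Ropp_involutive. Qed.

Lemma min_period_mirror F m x : min_period (fun x => - F (- x)) m x -> min_period F m (- x).
Proof.
intros [m1 [mx H]]. rewrite fiter_mirror in mx. split; [exact m1|]. split; [lra|].
intros j jm E. apply (H j jm). rewrite fiter_mirror. lra.
Qed.

Lemma orbit_family_mirror F t L : orbit_family (fun x => - F (- x)) t L ->
  orbit_family F t (map Ropp L).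
Proof.
intros [H1 H2]. split.
- intros x xL. apply in_map_iff in xL. destruct xL as [y [<- yL]].
  now apply min_period_mirror, H1.
- rewrite length_map. intros i j iL jL ij. rewrite <- Ropp_0, !map_nth.
  intros [d dE]. apply (H2 i j iL jL ij). exists d. rewrite fiter_mirror, dE. lra.
Qed.

Lemma cycle_on_mirror F N p s : cycle_on F N p s ->
  cycle_on (fun x => - F (- x)) N (fun i => - p (N - 1 - i)%nat)
    (fun i => N - 1 - s (N - 1 - i))%nat.
Proof.
intros [inc [st [tr mp]]]. split; [|split; [|split]].
- intros i j ij. apply Ropp_lt_contravar, inc. lia.
- intros i iN. destruct (st (N - 1 - i)%nat) as [r E]; [lia|]. split; [lia|].
  rewrite Ropp_involutive, E. do 2 f_equal. lia.
- intros i j iN jN. destruct (tr (N - 1 - i)%nat (N - 1 - j)%nat) as [k kE]; [lia | lia |].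
  exists k.
  assert (K : forall k, (Nat.iter k s (N - 1 - i) < N /\
    Nat.iter k (fun i => N - 1 - s (N - 1 - i)) i = N - 1 - Nat.iter k s (N - 1 - i))%nat).
  { clear k kE. induction k as [|k [IH1 IH2]]; simpl; [lia|]. rewrite IH2.
    split; [now apply st|]. do 2 f_equal. lia. }
  destruct (K k) as [_ ->]. lia.
- intros i iN. destruct (mp (N - 1 - i)%nat) as [m1 [m2 m3]]; [lia|]. split; [exact m1|].
  split.
  + now rewrite fiter_mirror, Ropp_involutive, m2.
  + intros j jN E. rewrite fiter_mirror, Ropp_involutive in E. apply (m3 j jN). lra.
Qed.

Lemma stefan_cycle_of_cycle F n p s : cycle_on F (2 * n + 1) p s ->
  (forall i, (i < 2 * n + 1)%nat -> s i = stefan n i) -> stefan_cycle F n p.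
Proof.
intros [inc [st _]] E. split.
- intros i j ij. apply inc. lia.
- intros i iN. rewrite <- E by lia. apply st. lia.
Qed.

Lemma minimal_odd_period_orbits F n t : continuity F -> (1 <= n)%nat ->
  (exists x, min_period F (2 * n + 1) x) ->
  (forall d x, Nat.Odd d -> (1 < d < 2 * n + 1)%nat -> ~ min_period F d x) ->
  (1 <= t)%nat -> (t <> 2 * n + 1)%nat ->
  exists L, orbit_family F t L /\ Z.of_nat (length L * t) = Phi n t.
Proof.
intros cF n1 [x xP] no t1 tn.
destruct (cycle_exists F _ x xP) as [p [s C]].
destruct (center_exists F _ p s C) as [m [mN [s1 s2]]]; [lia|].
assert (C' := C). destruct C' as [_ [st [tr mp]]].
assert (sr : forall i, (i < 2 * n + 1)%nat -> (s i < 2 * n + 1)%nat) by (intros; now apply st).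
(* If both ends of the gap moved beyond it, the first hull would have width at least 3, a head start
   of 2. Hull [2 n - 2] would then be everything, and a point keeping its side would give an odd
   period below [2 n + 1]. *)
assert (sides : s m = S m \/ s (S m) = m).
{ assert (M := hull_mono (2 * n + 1) m s mN s1 s2 0).
  apply NNPP. intro H.
  assert (K : (2 + 1 <= hi m s 1 - lo m s 1)%nat).
  { assert (I0 := hull_image (2 * n + 1) m s mN s1 s2 0 m).
    assert (I1 := hull_image (2 * n + 1) m s mN s1 s2 0 (S m)).
    change (lo m s 0) with m in *. change (hi m s 0) with (S m) in *. lia. }
  destruct (odd_cycle_has_nonswitching F n p s m C mN s1 s2) as [k [kN ns]].
  assert (W : (lo m s (2 * n - 2) <= k <= hi m s (2 * n - 2))%nat).
  { assert (HR := hull_range _ m s sr mN s1 s2 (2 * n - 2)).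
    destruct (Nat.eq_dec n 1) as [->|].
    - assert (HR1 := hull_range _ m s sr mN s1 s2 1). simpl in HR1, K |- *. lia.
    - destruct (hull_size_from _ m s sr tr mN s1 s2 1 2 (2 * n - 3)) as [Z|Z]; [exact K | |];
        replace (1 + (2 * n - 3))%nat with (2 * n - 2)%nat in Z by lia; lia. }
  destruct (nonswitching_odd_period F _ p s m _ k cF C mN s1 s2 W ns) as [d [y [dO [dr dP]]]].
  apply (no d y dO); [lia | exact dP]. }
destruct sides as [E|E].
- assert (SC : stefan_cycle F n p).
  { apply (stefan_cycle_of_cycle F n p s C).
    now apply (minimal_odd_cycle F n p s m). }
  destruct (stefan_cycle_orbits F n p SC t cF n1 t1 tn) as [L [L1 [L2 [_ L3]]]].
  exists L. split; [|exact L3]. split; [|exact L2]. intros y yL. now apply L1.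
(* Reflection exchanges the two ends of the gap and reduces this case to the previous one. *)
- set (G := fun x => - F (- x)).
  assert (CG := cycle_on_mirror F _ p s C). fold G in CG.
  assert (cG : continuity G) by now apply continuity_mirror.
  assert (SC : stefan_cycle G n (fun i => - p (2 * n + 1 - 1 - i)%nat)).
  { apply (stefan_cycle_of_cycle G n _ _ CG).
    apply (minimal_odd_cycle G n _ _ (2 * n - 1 - m)%nat cG n1 CG).
    - intros d y dO dr dP. apply min_period_mirror in dP. now apply (no d (- y)).
    - lia.
    - replace (2 * n + 1 - 1 - (2 * n - 1 - m))%nat with (S m) by lia. lia.
    - replace (2 * n + 1 - 1 - S (2 * n - 1 - m))%nat with m by lia. lia.
    - replace (2 * n + 1 - 1 - (2 * n - 1 - m))%nat with (S m) by lia. lia. }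
  destruct (stefan_cycle_orbits G n _ SC t cG n1 t1 tn) as [L [L1 [L2 [_ L3]]]].
  exists (map Ropp L). split; [|now rewrite length_map].
  apply orbit_family_mirror. split; [|exact L2]. intros y yL. now apply L1.
Qed.

Definition clamp (a b x : R) : R := Rmax a (Rmin b x).

Lemma clamp_in a b x : a <= b -> a <= clamp a b x <= b.
Proof.
intro ab. unfold clamp. split; [apply Rmax_l|]. apply Rmax_lub; [exact ab | apply Rmin_l].
Qed.

Lemma clamp_id a b x : a <= x <= b -> clamp a b x = x.
Proof. intro H. unfold clamp. rewrite Rmin_right, Rmax_right; lra. Qed.

Lemma clamp_cases a b x : a <= b -> clamp a b x = a \/ clamp a b x = b \/ a <= x <= b.
Proof.
intro ab. unfold clamp. destruct (Rle_dec x b).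
- rewrite Rmin_right by lra. destruct (Rle_dec a x); [right; right; lra|].
  left. apply Rmax_left. lra.
- rewrite Rmin_left by lra. right. left. apply Rmax_right. lra.
Qed.

Lemma clamp_lipschitz a b x y : Rabs (clamp a b x - clamp a b y) <= Rabs (x - y).
Proof.
unfold clamp, Rmax, Rmin.
repeat (destruct Rle_dec); unfold Rabs; repeat (destruct Rcase_abs); lra.
Qed.

Lemma continuity_clamp a b : continuity (clamp a b).
Proof.
apply continuity_of_eps. intros e eps He. exists eps. split; [exact He|].
intros y Hy. assert (L := clamp_lipschitz a b y e). lra.
Qed.

(* Replacing F twice by its truncation to the two halves only creates periodic points that touch
   the cycle P, and on P nothing was truncated. *)
Section Halving.
Variables (F : R -> R) (P : R -> Prop) (a0 b0 a1 b1 : R).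
Hypotheses (ab0 : a0 <= b0) (ab1 : a1 <= b1) (sep : b0 < a1).
Hypotheses (Pa0 : P a0) (Pb0 : P b0) (Pa1 : P a1) (Pb1 : P b1).
Hypothesis PF : forall x, P x -> P (F x).
Hypothesis PF0 : forall x, P x -> a0 <= x <= b0 -> a1 <= F x <= b1.
Hypothesis PF1 : forall x, P x -> a1 <= x <= b1 -> a0 <= F x <= b0.

Definition half_map (x : R) : R := clamp a0 b0 (F (clamp a1 b1 (F x))).

Definition untruncated (x : R) : Prop :=
  a0 <= x <= b0 /\ a1 <= F x <= b1 /\ a0 <= F (F x) <= b0.

Lemma half_map_untruncated x : untruncated x -> half_map x = F (F x).
Proof.
intros [_ [H1 H2]]. unfold half_map. rewrite (clamp_id a1) by exact H1. now apply clamp_id.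
Qed.

Lemma cycle_untruncated x : P x -> a0 <= x <= b0 -> untruncated x.
Proof.
intros Px xr. split; [exact xr|]. assert (H := PF0 x Px xr). split; [exact H|].
apply PF1; [now apply PF | exact H].
Qed.

(** A truncated value is an end of one of the halves, hence a point of [P], and [P] is invariant. *)
Lemma half_map_cases x : a0 <= x <= b0 -> untruncated x \/ P (half_map x).
Proof.
intro xr. destruct (classic (P (half_map x))) as [|nP]; [now right | left].
assert (H1 : a1 <= F x <= b1).
{ destruct (clamp_cases a1 b1 (F x) ab1) as [E|[E|E]]; [| |exact E];
    exfalso; apply nP; unfold half_map; rewrite E.
  - assert (K := PF1 a1 Pa1 ltac:(lra)). rewrite clamp_id by exact K. now apply PF.
  - assert (K := PF1 b1 Pb1 ltac:(lra)). rewrite clamp_id by exact K. now apply PF. }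
split; [exact xr|]. split; [exact H1|].
destruct (clamp_cases a0 b0 (F (F x)) ab0) as [E|[E|E]]; [| |exact E];
  exfalso; apply nP; unfold half_map; rewrite (clamp_id a1) by exact H1; now rewrite E.
Qed.

Lemma half_map_range x : a0 <= half_map x <= b0.
Proof. now apply clamp_in. Qed.

(** A periodic orbit that meets [P] stays in [P] from then on, hence always by periodicity, and
    nothing is truncated there. One that avoids [P] is never truncated either. *)
Lemma periodic_untruncated m x : (1 <= m)%nat -> fiter m half_map x = x ->
  forall i, untruncated (fiter i half_map x).
Proof.
intros m1 mx.
assert (per : forall q i, fiter (i + q * m) half_map x = fiter i half_map x).
{ intros q i. now rewrite fiter_add, fiter_mul. }
assert (rng : forall i, a0 <= fiter i half_map x <= b0).
{ intro i. rewrite <- (per 1%nat). replace (i + 1 * m)%nat with (S (i + m - 1)) by lia.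
  apply half_map_range. }
destruct (classic (exists i0, P (fiter i0 half_map x))) as [[i0 Pi0]|nP].
- assert (A : forall k, P (fiter (k + i0) half_map x)).
  { induction k as [|k IH]; [exact Pi0|]. simpl.
    assert (U := cycle_untruncated _ IH (rng _)).
    rewrite half_map_untruncated by exact U. now apply PF, PF. }
  intro i. apply cycle_untruncated; [|apply rng].
  rewrite <- (per i0). replace (i + i0 * m)%nat with (i + (i0 * m - i0) + i0)%nat by nia. apply A.
- intro i. destruct (half_map_cases (fiter i half_map x) (rng i)) as [U|Pn]; [exact U|].
  exfalso. apply nP. now exists (S i).
Qed.

Lemma fiter_half_map x : (forall i, untruncated (fiter i half_map x)) ->
  forall i, fiter i half_map x = fiter (2 * i) F x.
Proof.
intros U i. induction i as [|i IH]; [reflexivity|].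
replace (2 * S i)%nat with (S (S (2 * i))) by lia.
change (half_map (fiter i half_map x) = F (F (fiter (2 * i) F x))). rewrite <- IH.
exact (half_map_untruncated _ (U i)).
Qed.

(** At odd times the orbit under [F] is in the right half, which is disjoint from the left one. *)
Lemma same_orbit_half_map x y : (forall i, untruncated (fiter i half_map x)) ->
  a0 <= y <= b0 -> forall j, fiter j F x = y -> exists i, j = (2 * i)%nat /\ fiter i half_map x = y.
Proof.
intros U yr j E. destruct (Nat.Even_or_Odd j) as [[i I]|[i I]].
- exists i. split; [exact I|]. rewrite fiter_half_map by exact U. now rewrite <- I.
- exfalso. destruct (U i) as [_ [H _]]. rewrite fiter_half_map in H by exact U.
  rewrite I in E. replace (2 * i + 1)%nat with (S (2 * i)) in E by lia.
  change (F (fiter (2 * i) F x) = y) in E. lra.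
Qed.

Lemma min_period_half_map m x : min_period half_map m x -> min_period F (2 * m) x.
Proof.
intros [m1 [mx H]]. assert (U := periodic_untruncated m x m1 mx).
split; [lia|]. split.
- now rewrite <- fiter_half_map.
- intros j jm E. destruct (same_orbit_half_map x x U (proj1 (U 0%nat)) j E) as [i [I Ei]].
  apply (H i); [lia | exact Ei].
Qed.

Lemma half_map_min_period m x : P x -> a0 <= x <= b0 -> min_period F (2 * m) x ->
  min_period half_map m x.
Proof.
intros Px xr [m1 [mx H]].
assert (A : forall i, P (fiter i half_map x) /\ a0 <= fiter i half_map x <= b0).
{ induction i as [|i [IH1 IH2]]; [now split|]. simpl. split; [|apply half_map_range].
  rewrite half_map_untruncated by now apply cycle_untruncated. now apply PF, PF. }
assert (U : forall i, untruncated (fiter i half_map x)).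
{ intro i. now apply cycle_untruncated; apply A. }
split; [lia|]. split.
- now rewrite fiter_half_map.
- intros j jm E. rewrite fiter_half_map in E by exact U. apply (H (2 * j)%nat); [lia | exact E].
Qed.

Lemma orbit_family_half_map t L : (1 <= t)%nat -> orbit_family half_map t L -> orbit_family F (2 * t) L.
Proof.
intros t1 [H1 H2]. split.
- intros x xL. now apply min_period_half_map, H1.
- intros i j il jl ij [d dE]. apply (H2 i j il jl ij).
  destruct (H1 _ (nth_In L 0 il)) as [_ [xi _]]. destruct (H1 _ (nth_In L 0 jl)) as [_ [xj _]].
  assert (Ui := periodic_untruncated t _ t1 xi). assert (Uj := periodic_untruncated t _ t1 xj).
  destruct (same_orbit_half_map _ _ Ui (proj1 (Uj 0%nat)) d dE) as [e [_ E]].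
  now exists e.
Qed.

Lemma continuity_half_map : continuity F -> continuity half_map.
Proof.
intro cF. apply (continuity_comp (fun x => F (clamp a1 b1 (F x))) (clamp a0 b0));
  [|apply continuity_clamp].
apply (continuity_comp (fun x => clamp a1 b1 (F x)) F); [|exact cF].
apply (continuity_comp F (clamp a1 b1)); [exact cF | apply continuity_clamp].
Qed.
End Halving.

(** The induction step: the third property of [G] hands down the absence of preceding periods, the
    fourth brings the orbits found for [G] back to [F]. *)
Lemma halving F N : continuity F -> (1 <= N)%nat -> (exists x, min_period F (2 * N) x) ->
  (forall d x, Nat.Odd d -> (1 < d)%nat -> ~ min_period F d x) ->
  exists G, continuity G /\ (exists x, min_period G N x) /\
    (forall m x, min_period G m x -> min_period F (2 * m) x) /\
    (forall t L, (1 <= t)%nat -> orbit_family G t L -> orbit_family F (2 * t) L).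
Proof.
intros cF N1 [x xP] no. destruct (cycle_exists F _ x xP) as [p [s C]].
destruct (no_odd_period_all_switch F (2 * N) p s cF ltac:(lia) C no) as [m [mN sw]].
assert (C' := C). destruct C' as [inc [st [tr mp]]].
set (P := fun z => exists i, (i < 2 * N)%nat /\ z = p i).
assert (le := fun i j => cycle_le F (2 * N) p s i j C).
assert (ab0 : p 0%nat <= p m) by (apply le; lia).
assert (ab1 : p (S m) <= p (2 * N - 1)%nat) by (apply le; lia).
assert (sep : p m < p (S m)) by (apply inc; lia).
assert (PP : forall i, (i < 2 * N)%nat -> P (p i)) by (intros i iN; now exists i).
assert (PF : forall z, P z -> P (F z)).
{ intros z [i [iN ->]]. destruct (st i iN) as [r ->]. now apply PP. }
assert (left_iff : forall i, (i < 2 * N)%nat -> p i <= p m -> (i <= m)%nat).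
{ intros i iN H. destruct (Nat.le_gt_cases i m) as [|g]; [assumption|].
  assert (p m < p i) by (apply inc; lia). lra. }
assert (right_iff : forall i, (i < 2 * N)%nat -> p (S m) <= p i -> (m < i)%nat).
{ intros i iN H. destruct (Nat.lt_ge_cases m i) as [|g]; [assumption|].
  assert (p i < p (S m)) by (apply inc; lia). lra. }
assert (PF0 : forall z, P z -> p 0%nat <= z <= p m -> p (S m) <= F z <= p (2 * N - 1)%nat).
{ intros z [i [iN ->]] zr. assert (L := left_iff i iN ltac:(lra)).
  destruct (st i iN) as [r ->]. assert (Sw := sw i iN). unfold switches in Sw.
  split; apply le; lia. }
assert (PF1 : forall z, P z -> p (S m) <= z <= p (2 * N - 1)%nat -> p 0%nat <= F z <= p m).
{ intros z [i [iN ->]] zr. assert (L := right_iff i iN ltac:(lra)).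
  destruct (st i iN) as [r ->]. assert (Sw := sw i iN). unfold switches in Sw.
  split; apply le; lia. }
assert (P0 := PP 0%nat ltac:(lia)). assert (Pm := PP m ltac:(lia)).
assert (PSm := PP (S m) mN). assert (PN := PP (2 * N - 1)%nat ltac:(lia)).
exists (half_map F (p 0%nat) (p m) (p (S m)) (p (2 * N - 1)%nat)).
split; [now apply continuity_half_map|]. split; [|split].
- exists (p 0%nat). apply (half_map_min_period F P); trivial; [lra | apply mp; lia].
- intros q z. now apply (min_period_half_map F P).
- intros t L. now apply (orbit_family_half_map F P).
Qed.

Lemma pow2_odd_unique a o c q : Nat.Odd o -> Nat.Odd q -> (2 ^ a * o = 2 ^ c * q)%nat ->
  a = c /\ o = q.
Proof.
revert c. induction a as [|a IH]; intros [|c] O Q E.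
- simpl in E. split; [reflexivity | lia].
- exfalso. simpl in E. destruct O as [z Z]. lia.
- exfalso. simpl in E. destruct Q as [z Z]. lia.
- destruct (IH c O Q) as [-> ->]; [|now split]. simpl in E. lia.
Qed.

Lemma sh_prec_double x y : sh_prec (2 * x) (2 * y) <-> sh_prec x y.
Proof.
split; intros [a [o [c [q [O [Q [E1 [E2 H]]]]]]]].
- destruct a as [|a]; [exfalso; simpl in E1; destruct O as [z Z]; lia|].
  destruct c as [|c]; [exfalso; simpl in E2; destruct Q as [z Z]; lia|].
  exists a, o, c, q. simpl in E1, E2. repeat split; try assumption; try lia.
- exists (S a), o, (S c), q. simpl. repeat split; try assumption; try lia.
Qed.

Lemma sh_prec_odd n r : (1 <= n)%nat -> sh_prec r (2 * n + 1) <-> (Nat.Odd r /\ (1 < r < 2 * n + 1)%nat).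
Proof.
intro n1. split.
- intros [a [o [c [q [oO [qO [E1 [E2 H]]]]]]]].
  destruct (pow2_odd_unique 0 (2 * n + 1) c q) as [<- <-]; [now exists n | exact qO | simpl; lia |].
  destruct H as [[o1 [q1 [|[-> oq]]]]|[[o1 q1]|[o1 [q1 ac]]]]; try lia.
  simpl in E1. replace r with o by lia. split; [exact oO | lia].
- intros [rO rr]. exists 0%nat, r, 0%nat, (2 * n + 1)%nat. simpl.
  split; [exact rO|]. split; [now exists n|]. lia.
Qed.

Lemma sh_prec_odd_neq n t : (1 <= n)%nat -> sh_prec (2 * n + 1) t -> (t <> 2 * n + 1)%nat.
Proof. intros n1 H ->. apply sh_prec_odd in H; lia. Qed.

Lemma odd_sh_prec_even k n r : (1 <= n)%nat -> Nat.Odd r -> (1 < r)%nat ->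
  sh_prec r (2 * (2 ^ k * (2 * n + 1))).
Proof.
intros n1 O r1. exists 0%nat, r, (S k), (2 * n + 1)%nat. split; [exact O|].
split; [now exists n|]. simpl. lia.
Qed.

(** Each halving keeps the list of points and doubles the period, so the count is that of the odd
    case. The map is quantified after [k] because the induction changes it. *)
Lemma forced_orbits n k : (1 <= n)%nat -> forall F, continuity F ->
  (exists x, min_period F (2 ^ k * (2 * n + 1)) x) ->
  (forall r x, sh_prec r (2 ^ k * (2 * n + 1)) -> ~ min_period F r x) ->
  forall t, (1 <= t)%nat -> sh_prec (2 ^ k * (2 * n + 1)) (2 ^ k * t) ->
  exists L, orbit_family F (2 ^ k * t) L /\ Z.of_nat (length L * t) = Phi n t.
Proof.
intro n1. induction k as [|k IH]; intros F cF ex no t t1 st.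
- rewrite Nat.pow_0_r, !Nat.mul_1_l in *. apply minimal_odd_period_orbits; trivial.
  + intros d x dO dr. apply no. now apply sh_prec_odd.
  + now apply sh_prec_odd_neq.
- rewrite Nat.pow_succ_r', <- !Nat.mul_assoc in *.
  destruct (halving F (2 ^ k * (2 * n + 1)) cF) as [G [cG [exG [mG oG]]]].
  + assert (2 ^ k <> 0)%nat by (apply Nat.pow_nonzero; lia). nia.
  + exact ex.
  + intros d x dO d1. apply no. now apply odd_sh_prec_even.
  + destruct (IH G cG exG) with (t := t) as [L [L1 L2]]; trivial.
    * intros r x rs rG. apply (no (2 * r)%nat x); [now apply sh_prec_double | now apply mG].
    * now apply sh_prec_double.
    * exists L. split; [|exact L2]. apply oG; [|exact L1].
      assert (2 ^ k <> 0)%nat by (apply Nat.pow_nonzero; lia). nia.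
Qed.

(** * The piecewise affine model *)

Lemma continuity_Rmin f g : continuity f -> continuity g -> continuity (fun x => Rmin (f x) (g x)).
Proof.
intros cf cg. apply continuity_of_eps. intros e eps He.
destruct (continuity_eps f cf e eps He) as [d [dp H]].
destruct (continuity_eps g cg e eps He) as [d' [dp' H']].
exists (Rmin d d'). split; [now apply Rmin_glb_lt|]. intros y yd.
assert (A := H y (Rlt_le_trans _ _ _ yd (Rmin_l d d'))).
assert (B := H' y (Rlt_le_trans _ _ _ yd (Rmin_r d d'))).
apply Rabs_def2 in A. apply Rabs_def2 in B. apply Rabs_def1;
  unfold Rmin; repeat destruct Rle_dec; lra.
Qed.

Lemma continuity_Rmax f g : continuity f -> continuity g -> continuity (fun x => Rmax (f x) (g x)).
Proof.
intros cf cg. apply continuity_of_eps. intros e eps He.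
destruct (continuity_eps f cf e eps He) as [d [dp H]].
destruct (continuity_eps g cg e eps He) as [d' [dp' H']].
exists (Rmin d d'). split; [now apply Rmin_glb_lt|]. intros y yd.
assert (A := H y (Rlt_le_trans _ _ _ yd (Rmin_l d d'))).
assert (B := H' y (Rlt_le_trans _ _ _ yd (Rmin_r d d'))).
apply Rabs_def2 in A. apply Rabs_def2 in B. apply Rabs_def1;
  unfold Rmax; repeat destruct Rle_dec; lra.
Qed.

Lemma continuity_affine a b : continuity (fun x => a + b * x).
Proof. intro x. reg. Qed.

(* The piecewise affine map with nodes (i, stefan n i), 0 <= i <= 2n. *)
Definition stefan_map (n : nat) (x : R) : R :=
  Rmin (INR n + INR n * x)
    (Rmax (Rmin (2 * INR n + 1 + -1 * x) (3 * INR n + 1 + -2 * x)) (2 * INR n + -1 * x)).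

Lemma continuity_stefan_map n : continuity (stefan_map n).
Proof.
apply continuity_Rmin; [apply continuity_affine|].
apply continuity_Rmax; [|apply continuity_affine].
apply continuity_Rmin; apply continuity_affine.
Qed.

Definition slope (n k : nat) : R := INR (stefan n (S k)) - INR (stefan n k).

Lemma INR_sub_eq a b c : (a + b = c)%nat -> INR a = INR c - INR b.
Proof. intros <-. rewrite plus_INR. lra. Qed.

(** The active line has slope n on [0,1], -1 from 1 to n, -2 on [n,n+1] and -1 beyond. [Rmax]
    changes line at the corner (n+1, n-1), the outer [Rmin] at (1, 2n). *)
Lemma stefan_map_affine n k x : (1 <= n)%nat -> (k < 2 * n)%nat -> INR k <= x <= INR k + 1 ->
  stefan_map n x = INR (stefan n k) + (x - INR k) * slope n k.
Proof.
intros n1 kn xr. unfold slope, stefan_map.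
assert (N1 : 1 <= INR n) by (apply (le_INR 1); exact n1).
assert (K0 := pos_INR k).
assert (D : INR (2 * n) = 2 * INR n) by (rewrite mult_INR; reflexivity).
destruct (Nat.eq_dec k 0) as [->|k0].
- replace (stefan n 0) with n by reflexivity.
  replace (stefan n 1) with (2 * n)%nat by (destruct (stefan_cases n 1) as [|[|]]; lia).
  rewrite D. simpl INR in *.
  rewrite (Rmin_left (2 * INR n + 1 + -1 * x)) by lra.
  rewrite Rmax_left by lra. rewrite Rmin_left by nra. lra.
- assert (K1 : 1 <= INR k) by (apply (le_INR 1); lia).
  destruct (Nat.lt_trichotomy k n) as [l|[->|l]].
  + assert (kn1 : INR k + 1 <= INR n) by (rewrite <- S_INR; apply le_INR; lia).
    rewrite (INR_sub_eq (stefan n k) k (S (2 * n)))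
      by (destruct (stefan_cases n k) as [|[|]]; lia).
    rewrite (INR_sub_eq (stefan n (S k)) k (2 * n)%nat)
      by (destruct (stefan_cases n (S k)) as [|[|]]; lia).
    rewrite S_INR, D.
    rewrite (Rmin_left (2 * INR n + 1 + -1 * x)) by lra.
    rewrite Rmax_left by lra. rewrite Rmin_right by nra. lra.
  + rewrite (INR_sub_eq (stefan n n) 0 (S n))
      by (destruct (stefan_cases n n) as [|[|]]; lia).
    rewrite (INR_sub_eq (stefan n (S n)) 1 n)
      by (destruct (stefan_cases n (S n)) as [|[|]]; lia).
    rewrite S_INR. simpl INR.
    rewrite (Rmin_right (2 * INR n + 1 + -1 * x)) by lra.
    rewrite Rmax_left by lra. rewrite Rmin_right by nra. lra.
  + assert (kn1 : INR n + 1 <= INR k) by (rewrite <- S_INR; apply le_INR; lia).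
    rewrite (INR_sub_eq (stefan n k) k (2 * n))
      by (destruct (stefan_cases n k) as [|[|]]; lia).
    rewrite (INR_sub_eq (stefan n (S k)) (S k) (2 * n)%nat)
      by (destruct (stefan_cases n (S k)) as [|[|]]; lia).
    rewrite S_INR, D.
    rewrite (Rmin_right (2 * INR n + 1 + -1 * x)) by lra.
    rewrite Rmax_right by lra. rewrite Rmin_right by nra. lra.
Qed.

Lemma stefan_map_nodes n i : (1 <= n)%nat -> (i <= 2 * n)%nat ->
  stefan_map n (INR i) = INR (stefan n i).
Proof.
intros n1 H. destruct (Nat.eq_dec i (2 * n)) as [->|ne].
- destruct n as [|m]; [lia|]. replace (2 * S m)%nat with (S (2 * m + 1)) by lia.
  rewrite (stefan_map_affine (S m) (2 * m + 1)); [|lia | lia | rewrite S_INR; lra].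
  unfold slope. rewrite S_INR. ring.
- rewrite (stefan_map_affine n i); [|lia | lia | lra]. lra.
Qed.

Lemma stefan_map_cycle n : (1 <= n)%nat -> stefan_cycle (stefan_map n) n INR.
Proof.
intro n1. split.
- intros i j ij. apply lt_INR. lia.
- intros i H. now apply stefan_map_nodes.
Qed.

Lemma unit_interval N x : 0 <= x <= INR N -> (1 <= N)%nat ->
  exists k, (k < N)%nat /\ INR k <= x <= INR k + 1.
Proof.
induction N as [|N IH]; intros xr N1; [lia|].
destruct (Nat.eq_dec N 0) as [->|ne].
- exists 0%nat. simpl in *. split; [lia | lra].
- destruct (Rle_dec x (INR N)).
  + destruct IH as [k [kN kx]]; [lra | lia |]. exists k. split; [lia | exact kx].
  + exists N. rewrite S_INR in xr. split; [lia | lra].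
Qed.

Lemma slope_ge_1 n k : (1 <= n)%nat -> (k < 2 * n)%nat -> 1 <= Rabs (slope n k).
Proof.
intros n1 kn. unfold slope.
assert (H : (S (stefan n k) <= stefan n (S k) \/ S (stefan n (S k)) <= stefan n k)%nat).
{ destruct (stefan_cases n k) as [|[|]], (stefan_cases n (S k)) as [|[|]]; lia. }
destruct H as [H|H]; apply le_INR in H; rewrite S_INR in H.
- rewrite Rabs_right; lra.
- rewrite Rabs_left; lra.
Qed.

Lemma slope_ge_2 n k : (1 <= n)%nat -> k = n \/ (k = 0%nat /\ (2 <= n)%nat) -> 2 <= Rabs (slope n k).
Proof.
intros n1 H. unfold slope.
assert (K : (S (S (stefan n k)) <= stefan n (S k) \/ S (S (stefan n (S k))) <= stefan n k)%nat).
{ destruct (stefan_cases n k) as [|[|]], (stefan_cases n (S k)) as [|[|]]; lia. }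
destruct K as [K|K]; apply le_INR in K; rewrite !S_INR in K.
- rewrite Rabs_right; lra.
- rewrite Rabs_left; lra.
Qed.

Lemma covers_stefan_cases n i j : (1 <= n)%nat -> (i < 2 * n)%nat -> covers (stefan n) i j ->
  (i = 0 /\ n <= j < 2 * n)%nat \/ (0 < i < n /\ j = 2 * n - i)%nat \/
  (i = n /\ (j = n - 1 \/ j = n))%nat \/ (n < i /\ j = 2 * n - 1 - i)%nat.
Proof.
intros n1 hi c. unfold covers in c.
destruct (stefan_cases n i) as [|[|]], (stefan_cases n (S i)) as [|[|]]; lia.
Qed.

(** Away from the intervals 0 and [n] the successor is forced and has rank one less, so a walk
    reaches one of these two. For [n = 1] interval 0 has slope 1, but its only successor is interval
    1, which is [n]. *)
Lemma itinerary_expands n t w : (1 <= n)%nat -> itinerary n t w ->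
  exists i, w i = n \/ (w i = 0%nat /\ (2 <= n)%nat).
Proof.
intros n1 [wc _].
set (rank := fun k => if Nat.ltb k n then (2 * k)%nat else (2 * (2 * n - k) - 1)%nat).
assert (K : forall r i, (rank (w i) <= r)%nat -> exists i, w i = n \/ (w i = 0%nat /\ (2 <= n)%nat)).
{ induction r as [|r IH]; intros i ir.
  - destruct (wc i) as [wr c]. destruct (wc (S i)) as [wr' _].
    apply covers_stefan_cases in c; [|exact n1 | exact wr].
    unfold rank in ir. destruct (Nat.ltb_spec (w i) n).
    + destruct (Nat.eq_dec n 1) as [->|].
      * exists (S i). left. lia.
      * exists i. right. lia.
    + lia.
  - destruct (wc i) as [wr c]. destruct (wc (S i)) as [wr' _].
    apply covers_stefan_cases in c; [|exact n1 | exact wr].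
    destruct c as [[c1 c2]|[[c1 c2]|[[c1 c2]|[c1 c2]]]].
    + destruct (Nat.eq_dec n 1) as [->|].
      * exists (S i). left. lia.
      * exists i. right. lia.
    + apply (IH (S i)). unfold rank in *.
      destruct (Nat.ltb_spec (w i) n), (Nat.ltb_spec (w (S i)) n); lia.
    + exists i. now left.
    + apply (IH (S i)). unfold rank in *.
      destruct (Nat.ltb_spec (w i) n), (Nat.ltb_spec (w (S i)) n); lia. }
now apply (K (rank (w 0%nat)) 0%nat).
Qed.

(* Along a common itinerary two orbits never get closer, and they separate by a factor at least 2
   once per period. *)
Lemma follows_unique n t w x y : (1 <= n)%nat -> (1 <= t)%nat -> itinerary n t w ->
  follows (stefan_map n) INR w x -> follows (stefan_map n) INR w y ->
  fiter t (stefan_map n) x = x -> fiter t (stefan_map n) y = y -> x = y.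
Proof.
intros n1 t1 it fx fy tx ty. set (F := stefan_map n) in *.
set (d := fun i => Rabs (fiter i F x - fiter i F y)).
assert (dS : forall i, d (S i) = Rabs (slope n (w i)) * d i).
{ intro i. unfold d. simpl. assert (wr := proj1 (proj1 it i)).
  assert (ax := fx i). assert (ay := fy i). rewrite S_INR in ax, ay.
  unfold F at 1 3. rewrite !(stefan_map_affine n (w i)) by assumption.
  rewrite <- Rabs_mult. f_equal. ring. }
assert (dpos : forall i, 0 <= d i) by (intro; apply Rabs_pos).
assert (mono1 : forall i, d i <= d (S i)).
{ intro i. rewrite dS. assert (s := slope_ge_1 n (w i) n1 (proj1 (proj1 it i))).
  assert (p := dpos i). nra. }
assert (mono : forall k i, d i <= d (k + i)%nat).
{ induction k as [|k IH]; intro i; [simpl; lra|]. simpl.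
  assert (a := IH i). assert (b := mono1 (k + i)%nat). lra. }
destruct (itinerary_expands n t w n1 it) as [i iP].
assert (per : d (i + t)%nat = d i) by (unfold d; now rewrite !fiter_add, tx, ty).
assert (big : 2 * d i <= d (S i)).
{ rewrite dS. assert (s := slope_ge_2 n (w i) n1 iP). assert (p := dpos i). nra. }
assert (a := mono (t - 1)%nat (S i)). replace (t - 1 + S i)%nat with (i + t)%nat in a by lia.
assert (b := mono i 0%nat). rewrite Nat.add_0_r in b. assert (p := dpos 0%nat).
assert (z : d 0%nat = 0) by lra. unfold d in z. simpl in z.
destruct (Req_dec (x - y) 0); [lra|]. now apply Rabs_no_R0 in z.
Qed.

Lemma stefan_map_interval n x : (1 <= n)%nat -> 0 <= x <= INR (2 * n) ->
  0 <= stefan_map n x <= INR (2 * n).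
Proof.
intros n1 xr. destruct (unit_interval (2 * n) x xr) as [k [kn kx]]; [lia|].
rewrite (stefan_map_affine n k) by assumption. unfold slope.
assert (A := pos_INR (stefan n k)). assert (B := pos_INR (stefan n (S k))).
assert (A' := le_INR _ _ (stefan_range n k ltac:(lia))).
assert (B' := le_INR _ _ (stefan_range n (S k) ltac:(lia))). nra.
Qed.

(** The map is monotone on the interval and sends its ends to integers, so an image inside the open
    interval [j] forces all of it to be covered. *)
Lemma stefan_map_covers n k j x : (1 <= n)%nat -> (k < 2 * n)%nat ->
  INR k < x < INR k + 1 -> INR j < stefan_map n x < INR j + 1 -> covers (stefan n) k j.
Proof.
intros n1 kn kx jx. rewrite (stefan_map_affine n k) in jx by (assumption || lra).
unfold slope in jx. unfold covers.
assert (H : (stefan n k < stefan n (S k) \/ stefan n (S k) < stefan n k)%nat).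
{ destruct (stefan_cases n k) as [|[|]], (stefan_cases n (S k)) as [|[|]]; lia. }
destruct H as [H|H]; apply lt_INR in H; [left|right]; split.
- assert (stefan n k < S j)%nat; [|lia]. apply INR_lt. rewrite S_INR. nra.
- apply INR_lt. nra.
- assert (stefan n (S k) < S j)%nat; [|lia]. apply INR_lt. rewrite S_INR. nra.
- apply INR_lt. nra.
Qed.

(** A period other than [2 n + 1] keeps the orbit off the integers, so its itinerary is unambiguous.
    If the itinerary had a shorter period [e], then [x] and its [e]-th iterate would share it and
    coincide. *)
Lemma stefan_map_itinerary n t x : (1 <= n)%nat -> (1 <= t)%nat -> (t <> 2 * n + 1)%nat ->
  0 <= x <= INR (2 * n) -> min_period (stefan_map n) t x ->
  exists w, itinerary n t w /\ follows (stefan_map n) INR w x /\ aperiodic t w.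
Proof.
intros n1 t1 tn xr mp. set (F := stefan_map n) in *.
assert (SC := stefan_map_cycle n n1). fold F in SC.
assert (rng : forall i, 0 <= fiter i F x <= INR (2 * n)).
{ induction i as [|i IH]; [exact xr|]. simpl. now apply stefan_map_interval. }
assert (off : forall i y, (y <= 2 * n)%nat -> fiter i F x <> INR y).
{ intros i y yr E. apply tn.
  assert (m1 := min_period_iter F t i x mp). rewrite E in m1.
  assert (m2 := stefan_p_min_period F n INR SC y yr).
  assert (D1 := min_period_divide F _ _ _ m1 (proj1 (proj2 m2))).
  assert (D2 := min_period_divide F _ _ _ m2 (proj1 (proj2 m1))).
  now apply Nat.divide_antisym. }
assert (ex : forall i, exists k, (k < 2 * n)%nat /\ INR k < fiter i F x < INR k + 1).
{ intro i. destruct (unit_interval (2 * n) _ (rng i)) as [k [kn kx]]; [lia|].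
  assert (o1 := off i k). assert (o2 := off i (S k)). rewrite S_INR in o2.
  exists k. split; [exact kn|].
  assert (fiter i F x <> INR k) by (apply o1; lia).
  assert (fiter i F x <> INR k + 1) by (apply o2; lia). lra. }
set (w := fun i => proj1_sig (constructive_indefinite_description _ (ex i))).
assert (wP : forall i, (w i < 2 * n)%nat /\ INR (w i) < fiter i F x < INR (w i) + 1).
{ intro i. exact (proj2_sig (constructive_indefinite_description _ (ex i))). }
assert (uniq : forall i j z, INR i < z < INR i + 1 -> INR j < z < INR j + 1 -> i = j).
{ intros i j z zi zj.
  assert (i < S j)%nat by (apply INR_lt; rewrite S_INR; lra).
  assert (j < S i)%nat by (apply INR_lt; rewrite S_INR; lra). lia. }
assert (it : itinerary n t w).
{ split.
  - intro i. destruct (wP i) as [wr wx]. split; [exact wr|].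
    apply (stefan_map_covers n _ _ (fiter i F x) n1 wr wx). apply (wP (S i)).
  - intro i. apply (uniq _ _ (fiter i F x)); [|apply wP].
    destruct mp as [_ [tx _]]. rewrite <- tx at 1 2. rewrite <- fiter_add. apply wP. }
assert (fo : follows F INR w x).
{ intro i. rewrite S_INR. destruct (wP i). lra. }
exists w. split; [exact it|]. split; [exact fo|].
intros e er. apply NNPP. intro none.
assert (same : forall i, w (i + e)%nat = w i).
{ intro i. apply NNPP. intro ne. apply none. now exists i. }
destruct mp as [_ [tx least]]. apply (least e er).
apply (follows_unique n t w); trivial.
- intro i. fold F. rewrite <- fiter_add, <- same. apply fo.
- fold F. now rewrite <- fiter_add, Nat.add_comm, fiter_add, tx.
Qed.

Lemma itinerary_shift n t w d : itinerary n t w -> itinerary n t (fun i => w (i + d)%nat).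
Proof.
intros [wc wp]. split.
- intro i. apply (wc (i + d)%nat).
- intro i. rewrite <- (wp (i + d)%nat). f_equal. lia.
Qed.

Lemma same_orbit_iter F m d x : (1 <= m)%nat -> fiter m F x = x -> same_orbit F (fiter d F x) x.
Proof.
intros m1 mx. exists (d * m - d)%nat. rewrite <- fiter_add.
replace (d * m - d + d)%nat with (d * m)%nat by nia. now apply fiter_mul.
Qed.

Lemma stefan_map_exact n t : (1 <= n)%nat -> (1 <= t)%nat -> (t <> 2 * n + 1)%nat ->
  exists L, (forall x, In x L -> 0 <= x <= INR (2 * n)) /\ orbit_family (stefan_map n) t L /\
    covers_orbits (stefan_map n) 0 (INR (2 * n)) t L /\ Z.of_nat (length L * t) = Phi n t.
Proof.
intros n1 t1 tn. set (F := stefan_map n).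
assert (SC := stefan_map_cycle n n1). fold F in SC.
destruct (stefan_cycle_orbits F n INR SC t (continuity_stefan_map n) n1 t1 tn)
  as [L [L1 [L2 [L3 L4]]]].
exists L. split; [intros x xL; now apply L1|]. split.
{ split; [intros x xL; now apply L1 | exact L2]. }
split; [|exact L4]. intros y yr mp.
destruct (stefan_map_itinerary n t y n1 t1 tn yr mp) as [w [it [fo ap]]].
destruct (L3 w it ap) as [x [d [xL fx]]]. exists x. split; [exact xL|].
destruct (L1 x xL) as [_ [_ [tx _]]]. destruct mp as [_ [ty _]].
(* Both points follow the itinerary of [y] shifted by [d]. *)
assert (E : x = fiter d F y).
{ apply (follows_unique n t (fun i => w (i + d)%nat)); trivial.
  - now apply itinerary_shift.
  - intro i. fold F. rewrite <- fiter_add. apply fo.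
  - fold F. now rewrite <- fiter_add, Nat.add_comm, fiter_add, ty. }
rewrite E. now apply (same_orbit_iter F t).
Qed.

(* Off the self-loop at the centre a walk alternates sides, so an odd closed walk uses that loop;
   once it leaves the centre it is forced through all 2n intervals before returning. *)
Lemma short_odd_itinerary n r w : (1 <= n)%nat -> Nat.Odd r -> (r < 2 * n + 1)%nat ->
  itinerary n r w -> forall i, w i = n.
Proof.
intros n1 rO rn [wc wp].
assert (step : forall i, (w i = 0 /\ n <= w (S i) < 2 * n)%nat \/
  (0 < w i < n /\ w (S i) = 2 * n - w i)%nat \/
  (w i = n /\ (w (S i) = n - 1 \/ w (S i) = n))%nat \/
  (n < w i /\ w (S i) = 2 * n - 1 - w i)%nat).
{ intro i. destruct (wc i) as [wr c]. now apply covers_stefan_cases. }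
assert (loop : exists i, w i = n /\ w (S i) = n).
{ apply NNPP. intro none.
  assert (alt : forall i, (w i < n <-> n <= w (S i))%nat).
  { intro i. assert (H := step i). assert (wr := proj1 (wc i)).
    assert (~ (w i = n /\ w (S i) = n)) by (intro Z; apply none; now exists i). lia. }
  assert (alt2 : forall i, (w (S (S i)) < n <-> w i < n)%nat).
  { intro i. assert (a := alt i). assert (b := alt (S i)). lia. }
  assert (even : forall j i, (w (2 * j + i) < n <-> w i < n)%nat).
  { induction j as [|j IH]; intro i; [reflexivity|].
    replace (2 * S j + i)%nat with (S (S (2 * j + i))) by lia. now rewrite alt2. }
  destruct rO as [j J]. assert (E := wp 0%nat). simpl in E. rewrite J in E.
  replace (2 * j + 1)%nat with (S (2 * j + 0)) in E by lia.
  assert (a := alt (2 * j + 0)%nat). assert (b := even j 0%nat). rewrite E in a. lia. }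
destruct loop as [i0 [l0 l1]].
set (v := fun k => w (k + i0)%nat).
assert (vstep : forall k, (v k = 0 /\ n <= v (S k) < 2 * n)%nat \/
  (0 < v k < n /\ v (S k) = 2 * n - v k)%nat \/
  (v k = n /\ (v (S k) = n - 1 \/ v (S k) = n))%nat \/
  (n < v k /\ v (S k) = 2 * n - 1 - v k)%nat) by (intro k; apply (step (k + i0)%nat)).
assert (const : forall k, (k <= r)%nat -> v k = n).
{ apply NNPP. intro none.
  assert (first : exists T, (T <= r)%nat /\ v T <> n /\ forall k, (k < T)%nat -> v k = n).
  { apply NNPP. intro nofirst. apply none.
    induction k as [k IH] using lt_wf_ind. intro kr. apply NNPP. intro ne.
    apply nofirst. exists k. split; [exact kr|]. split; [exact ne|].
    intros j jk. apply IH; lia. }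
  destruct first as [T [Tr [Tne before]]].
  assert (v0 : v 0%nat = n) by exact l0. assert (v1 : v 1%nat = n) by exact l1.
  assert (vr : v r = n).
  { rewrite <- v0. unfold v. rewrite Nat.add_comm. apply wp. }
  (* Since [v] is [n] at times 0 and 1, the departure time [T] is at least 2. Hence fewer than
     [2 n - 1] steps remain until [r], too few for the forced tour to come back to [n]. *)
  assert (T <> 0)%nat by congruence. assert (T <> 1)%nat by congruence.
  assert (T <> r)%nat by congruence.
  assert (spiral : forall j, (2 * j + 1 < 2 * n)%nat ->
     v (T + 2 * j)%nat = (n - 1 - j)%nat /\ ((2 * j + 2 < 2 * n)%nat -> v (T + 2 * j + 1)%nat = (n + 1 + j)%nat)).
  { induction j as [|j IH]; intro jn.
    - assert (e : v (T + 2 * 0)%nat = (n - 1 - 0)%nat).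
      { assert (b := before (T - 1)%nat ltac:(lia)). assert (s := vstep (T - 1)%nat).
        replace (S (T - 1)) with T in s by lia. replace (T + 2 * 0)%nat with T by lia. lia. }
      split; [exact e|]. intro jn'. assert (s := vstep (T + 2 * 0)%nat).
      replace (T + 2 * 0 + 1)%nat with (S (T + 2 * 0)) by lia. lia.
    - destruct IH as [_ IH]; [lia|]. specialize (IH ltac:(lia)).
      assert (e : v (T + 2 * S j)%nat = (n - 1 - S j)%nat).
      { assert (s := vstep (T + 2 * j + 1)%nat).
        replace (T + 2 * S j)%nat with (S (T + 2 * j + 1)) by lia. lia. }
      split; [exact e|]. intro jn'. assert (s := vstep (T + 2 * S j)%nat).
      replace (T + 2 * S j + 1)%nat with (S (T + 2 * S j)) by lia. lia. }
  assert (far : (r - T < 2 * n - 1)%nat) by lia.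
  destruct (Nat.Even_or_Odd (r - T)) as [[j J]|[j J]].
  - destruct (spiral j) as [e _]; [lia|]. replace (T + 2 * j)%nat with r in e by lia. lia.
  - destruct (spiral j) as [_ e]; [lia|]. specialize (e ltac:(lia)).
    replace (T + 2 * j + 1)%nat with r in e by lia. lia. }
assert (r1 : (1 <= r)%nat) by (destruct rO; lia).
assert (wr : forall q i, w (i + q * r)%nat = w i).
{ induction q as [|q IH]; intro i; [f_equal; lia|].
  replace (i + S q * r)%nat with (i + q * r + r)%nat by lia. now rewrite wp. }
intro i. rewrite <- (wr i0 i).
assert (E : (i + i0 * r = ((i + i0 * r - i0) mod r + i0) + ((i + i0 * r - i0) / r) * r)%nat).
{ assert (D := Nat.div_mod_eq (i + i0 * r - i0) r). assert (i0 <= i0 * r)%nat by nia. lia. }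
rewrite E, wr. apply (const ((i + i0 * r - i0) mod r)%nat).
apply Nat.lt_le_incl, Nat.mod_upper_bound. lia.
Qed.

Lemma stefan_map_no_short_odd n r x : (1 <= n)%nat -> Nat.Odd r -> (1 < r < 2 * n + 1)%nat ->
  0 <= x <= INR (2 * n) -> ~ min_period (stefan_map n) r x.
Proof.
intros n1 rO rr xr mp.
destruct (stefan_map_itinerary n r x) as [w [it [_ ap]]]; [lia | lia | lia | exact xr | exact mp |].
destruct (ap 1%nat) as [i ne]; [lia|]. apply ne.
now rewrite !(short_odd_itinerary n r w n1 rO ltac:(lia) it).
Qed.

(** * Doubling periods *)

Section Doubling.
Variables (f : R -> R) (a b : R).
Hypothesis ab : a < b.
Hypothesis f_in : maps_into f a b.

(** This shift makes the gap between the two copies as long as [a,b]. The line across it from (b, f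
    b + h) to (a + h, a) then has slope at most -h/(b-a) = -2, because [f b] is at least [a]. *)
Let h := 2 * (b - a).
Let mid_slope := (a - f b - h) / (b - a).

(* [a,b] is sent to [a,b]+h by f and sent back by a translation; the gap is crossed with slope
   at most -2, so it carries a single periodic orbit, a fixed point. *)
Definition double_map (x : R) : R :=
  f (clamp a b x) + h + mid_slope * (clamp b (a + h) x - b) + (clamp (a + h) (b + h) x - (a + h)).

Lemma clamp_low c d x : c <= d -> x <= c -> clamp c d x = c.
Proof. intros cd xc. unfold clamp. rewrite Rmin_right, Rmax_left; lra. Qed.

Lemma clamp_high c d x : c <= d -> d <= x -> clamp c d x = d.
Proof. intros cd xc. unfold clamp. rewrite Rmin_left, Rmax_right; lra. Qed.

Lemma h_gap : b < a + h.
Proof. unfold h. lra. Qed.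

Lemma double_map_left x : a <= x <= b -> double_map x = f x + h.
Proof.
intro H. assert (g := h_gap). unfold double_map.
rewrite (clamp_id a), (clamp_low b), (clamp_low (a + h)); lra.
Qed.

Lemma double_map_mid x : b <= x <= a + h -> double_map x = f b + h + mid_slope * (x - b).
Proof.
intro H. assert (g := h_gap). unfold double_map.
rewrite (clamp_high a), (clamp_id b), (clamp_low (a + h)); lra.
Qed.

Lemma double_map_right x : a + h <= x <= b + h -> double_map x = x - h.
Proof.
intro H. assert (g := h_gap). unfold double_map.
rewrite (clamp_high a), (clamp_high b), (clamp_id (a + h)); try lra.
unfold mid_slope. unfold h. field. lra.
Qed.

Lemma mid_slope_steep : mid_slope <= -2.
Proof.
assert (fb := f_in b ltac:(lra)). unfold mid_slope.
apply Rmult_le_reg_r with (b - a); [lra|].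
unfold Rdiv. rewrite Rmult_assoc, Rinv_l by lra. unfold h. lra.
Qed.

Lemma continuity_double_map : continuity (fun x => f (clamp a b x)) -> continuity double_map.
Proof.
intro cf. unfold double_map.
assert (c1 := continuity_clamp b (a + h)). assert (c2 := continuity_clamp (a + h) (b + h)).
assert (k : forall c : R, continuity (fun _ => c)) by (intros c x; reg).
apply (continuity_plus (fun x => f (clamp a b x) + h + mid_slope * (clamp b (a + h) x - b))
  (fun x => clamp (a + h) (b + h) x - (a + h))).
- apply (continuity_plus (fun x => f (clamp a b x) + h) (fun x => mid_slope * (clamp b (a + h) x - b))).
  + now apply (continuity_plus (fun x => f (clamp a b x)) (fun _ => h)).
  + apply (continuity_mult (fun _ => mid_slope) (fun x => clamp b (a + h) x - b)); [apply k|].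
    now apply (continuity_minus (clamp b (a + h)) (fun _ => b)).
- now apply (continuity_minus (clamp (a + h) (b + h)) (fun _ => a + h)).
Qed.

Lemma double_map_in : maps_into double_map a (b + h).
Proof.
intros x xr. assert (g := h_gap).
destruct (Rle_dec x b).
- rewrite double_map_left by lra. assert (H := f_in x ltac:(lra)). unfold h in *. lra.
- destruct (Rle_dec x (a + h)).
  + rewrite double_map_mid by lra. assert (fb := f_in b ltac:(lra)).
    assert (E : mid_slope * (b - a) = a - f b - h) by (unfold mid_slope; field; lra).
    assert (s := mid_slope_steep).
    assert (mid_slope * (b - a) <= mid_slope * (x - b) <= 0).
    { split; [|nra]. assert (x - b <= b - a) by (unfold h in *; lra). nra. }
    lra.
  + rewrite double_map_right by lra. lra.
Qed.

Lemma fiter_in i x : a <= x <= b -> a <= fiter i f x <= b.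
Proof. intro H. induction i as [|i IH]; [exact H | now apply f_in]. Qed.

Lemma fiter_double_map i x : a <= x <= b ->
  fiter (2 * i) double_map x = fiter i f x /\
  fiter (2 * i + 1) double_map x = fiter (S i) f x + h.
Proof.
intro xr. induction i as [|i [IH1 IH2]].
- split; [reflexivity|]. simpl. now apply double_map_left.
- assert (E : fiter (2 * S i) double_map x = fiter (S i) f x).
  { replace (2 * S i)%nat with (S (2 * i + 1)) by lia.
    change (double_map (fiter (2 * i + 1) double_map x) = fiter (S i) f x).
    assert (r := fiter_in (S i) x xr).
    rewrite IH2, double_map_right; lra. }
  split; [exact E|]. replace (2 * S i + 1)%nat with (S (2 * S i)) by lia.
  change (double_map (fiter (2 * S i) double_map x) = fiter (S (S i)) f x + h).
  rewrite E. apply double_map_left. now apply fiter_in.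
Qed.

Lemma double_map_return j x y : a <= x <= b -> a <= y <= b -> fiter j double_map x = y ->
  exists i, j = (2 * i)%nat /\ fiter i f x = y.
Proof.
intros xr yr E. destruct (Nat.Even_or_Odd j) as [[i ->]|[i ->]].
- exists i. split; [reflexivity|]. now rewrite <- (proj1 (fiter_double_map i x xr)).
- exfalso. rewrite (proj2 (fiter_double_map i x xr)) in E.
  assert (r := fiter_in (S i) x xr). assert (g := h_gap). lra.
Qed.

Lemma min_period_double_map m x : a <= x <= b -> min_period f m x -> min_period double_map (2 * m) x.
Proof.
intros xr [m1 [mx H]]. split; [lia|]. split; [now rewrite (proj1 (fiter_double_map m x xr))|].
intros j jm E. destruct (double_map_return j x x xr xr E) as [i [-> iE]].
apply (H i); [lia | exact iE].
Qed.

Lemma double_map_min_period r x : a <= x <= b -> min_period double_map r x ->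
  exists m, r = (2 * m)%nat /\ min_period f m x.
Proof.
intros xr [r1 [rx H]]. destruct (double_map_return r x x xr xr rx) as [m [-> mE]].
exists m. split; [reflexivity|]. split; [lia|]. split; [exact mE|].
intros j jm E. apply (H (2 * j)%nat); [lia|]. now rewrite (proj1 (fiter_double_map j x xr)).
Qed.

(** The right copy is sent to [a,b], so an orbit missing [a,b] stays in the open gap. There the
    distance of consecutive iterates is at least doubled at each step; on a periodic orbit it must
    be 0, which means a fixed point. *)
Lemma double_map_meets_left r y : a <= y <= b + h -> min_period double_map r y -> r <> 1%nat ->
  exists j, a <= fiter j double_map y <= b.
Proof.
intros yr [r1 [ry H]] rn. apply NNPP. intro none.
assert (rng : forall j, a <= fiter j double_map y <= b + h).
{ induction j as [|j IH]; [exact yr | now apply double_map_in]. }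
assert (midr : forall j, b < fiter j double_map y < a + h).
{ intro j. assert (R := rng j). assert (R' := rng (S j)). simpl in R'. split.
  - destruct (Rlt_le_dec b (fiter j double_map y)); [assumption|]. exfalso. apply none.
    exists j. lra.
  - destruct (Rlt_le_dec (fiter j double_map y) (a + h)); [assumption|]. exfalso. apply none.
    exists (S j). simpl. rewrite double_map_right; lra. }
set (e := fun j => Rabs (fiter (S j) double_map y - fiter j double_map y)).
assert (eS : forall j, e (S j) = Rabs mid_slope * e j).
{ intro j. unfold e. rewrite <- Rabs_mult.
  assert (M := midr j). assert (M' := midr (S j)).
  change (fiter (S (S j)) double_map y) with (double_map (fiter (S j) double_map y)).
  rewrite (double_map_mid (fiter (S j) double_map y)) by lra.
  change (fiter (S j) double_map y) with (double_map (fiter j double_map y)) at 2.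
  rewrite (double_map_mid (fiter j double_map y)) by lra. f_equal. ring. }
assert (steep : 2 <= Rabs mid_slope).
{ assert (s := mid_slope_steep). rewrite Rabs_left; lra. }
assert (epos : forall j, 0 <= e j) by (intro; apply Rabs_pos).
assert (mono : forall j, e 0%nat <= e j).
{ induction j as [|j IH]; [lra|]. rewrite eS. assert (p := epos j). nra. }
assert (per : e r = e 0%nat).
{ unfold e. replace (S r) with (1 + r)%nat by lia. rewrite fiter_add, ry. reflexivity. }
assert (e0 : e 0%nat = 0).
{ destruct r as [|r]; [lia|]. rewrite eS in per. assert (a1 := mono r).
  assert (p := epos 0%nat). assert (p' := epos r). nra. }
apply (H 1%nat); [lia|]. unfold e in e0.
destruct (Req_dec (fiter 1 double_map y - fiter 0 double_map y) 0) as [z|z].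
- simpl in z |- *. lra.
- now apply Rabs_no_R0 in z.
Qed.

Lemma orbit_family_double_map t L : (forall x, In x L -> a <= x <= b) ->
  orbit_family f t L -> orbit_family double_map (2 * t) L.
Proof.
intros Lr [H1 H2]. split.
- intros x xL. apply min_period_double_map; [now apply Lr | now apply H1].
- intros i j il jl ij [d dE]. apply (H2 i j il jl ij).
  destruct (double_map_return d _ _ (Lr _ (nth_In L 0 il)) (Lr _ (nth_In L 0 jl)) dE) as [e [_ E]].
  now exists e.
Qed.

(** An orbit of even period meets [a,b]; there it is an orbit of [f], hence listed, and one goes on
    along it to return to [y]. *)
Lemma covers_orbits_double_map t L : (1 <= t)%nat -> (forall x, In x L -> a <= x <= b) ->
  covers_orbits f a b t L -> covers_orbits double_map a (b + h) (2 * t) L.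
Proof.
intros t1 Lr H y yr mp.
destruct (double_map_meets_left (2 * t) y yr mp ltac:(lia)) as [j jr].
destruct (double_map_min_period (2 * t) _ jr (min_period_iter _ _ j y mp)) as [m [mE mz]].
replace m with t in mz by lia.
destruct (H _ jr mz) as [x [xL [i iE]]]. exists x. split; [exact xL|].
destruct mp as [_ [ty _]].
destruct (same_orbit_iter double_map (2 * t) j y ltac:(lia) ty) as [q qE].
exists (q + 2 * i)%nat.
rewrite fiter_add, (proj1 (fiter_double_map i x (Lr x xL))), iE. exact qE.
Qed.
End Doubling.

(** This disposes of period 1, the one period whose orbits need not meet the left copy. *)
Lemma sh_prec_one y : ~ sh_prec 1 y.
Proof.
intros [u [o [v [q [oO [qO [E1 [E2 H]]]]]]]].
destruct (pow2_odd_unique 0 1 u o) as [<- <-]; [now exists 0%nat | exact oO | simpl in *; lia |].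
lia.
Qed.

(** The strict inequality [a < b] lets the doubling divide by [b - a], and continuity is stated for
    the clamped map because [double_map] is built from it. A single map serves all [t]. *)
Lemma sharp_example n k : (1 <= n)%nat -> exists a b f, a < b /\
  continuity (fun x => f (clamp a b x)) /\ maps_into f a b /\
  has_orbit_of_period f a b (2 ^ k * (2 * n + 1)) /\
  (forall r, sh_prec r (2 ^ k * (2 * n + 1)) -> ~ has_orbit_of_period f a b r) /\
  forall t, (1 <= t)%nat -> sh_prec (2 ^ k * (2 * n + 1)) (2 ^ k * t) ->
    exists L, (forall x, In x L -> a <= x <= b) /\ orbit_family f (2 ^ k * t) L /\
      covers_orbits f a b (2 ^ k * t) L /\ Z.of_nat (length L * t) = Phi n t.
Proof.
intro n1. induction k as [|k IH].
- exists 0, (INR (2 * n)), (stefan_map n).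
  split; [apply (lt_INR 0); lia|]. split; [|split; [|split; [|split]]].
  + apply (continuity_comp (clamp 0 (INR (2 * n))) (stefan_map n));
      [apply continuity_clamp | apply continuity_stefan_map].
  + intros x xr. now apply stefan_map_interval.
  + exists (INR n). split; [split; [apply pos_INR | apply le_INR; lia]|].
    rewrite Nat.pow_0_r, Nat.mul_1_l.
    apply (stefan_p_min_period _ n INR (stefan_map_cycle n n1)). lia.
  + rewrite Nat.pow_0_r, Nat.mul_1_l. intros r rs [x [xr mp]].
    apply (sh_prec_odd n r n1) in rs. destruct rs as [rO rr].
    now apply (stefan_map_no_short_odd n r x).
  + rewrite Nat.pow_0_r. intros t t1 st. rewrite Nat.mul_1_l in st. rewrite Nat.mul_1_l in st.
    rewrite Nat.mul_1_l.
    apply stefan_map_exact; trivial. now apply sh_prec_odd_neq.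
- destruct IH as [a [b [f [ab [cf [fin [ex [no tt]]]]]]]].
  assert (pk : (2 ^ k <> 0)%nat) by (apply Nat.pow_nonzero; lia).
  rewrite !Nat.pow_succ_r', <- !Nat.mul_assoc in *.
  exists a, (b + 2 * (b - a)), (double_map f a b).
  split; [lra|]. split; [|split; [|split; [|split]]].
  + apply (continuity_comp (clamp a (b + 2 * (b - a))) (double_map f a b));
      [apply continuity_clamp | now apply continuity_double_map].
  + now apply double_map_in.
  + destruct ex as [x [xr mp]]. exists x. split; [lra|].
    now apply min_period_double_map.
  + intros r rs [y [yr mp]].
    destruct (Nat.eq_dec r 1) as [->|rn]; [now apply sh_prec_one in rs|].
    destruct (double_map_meets_left f a b ab fin r y yr mp rn) as [j jr].
    destruct (double_map_min_period f a b ab fin r _ jr (min_period_iter _ _ j y mp)) as [m [-> mz]].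
    apply (no m); [exact (proj1 (sh_prec_double _ _) rs)|]. now exists (fiter j (double_map f a b) y).
  + intros t t1 st.
    destruct (tt t t1) as [L [L1 [L2 [L3 L4]]]].
    { rewrite <- Nat.mul_assoc in st. exact (proj1 (sh_prec_double _ _) st). }
    exists L. split; [intros x xL; assert (r := L1 x xL); lra|]. split; [|split].
    * rewrite <- Nat.mul_assoc. now apply orbit_family_double_map.
    * rewrite <- Nat.mul_assoc. apply covers_orbits_double_map; trivial. nia.
    * exact L4.
Qed.

(** * Passage between the interval and the line *)

Lemma continuity_clamped f a b : a <= b -> continuous_on_interval f a b ->
  continuity (fun x => f (clamp a b x)).
Proof.
intros ab cf. apply continuity_of_eps. intros e eps He.
destruct (cf (clamp a b e) (clamp_in a b e ab) eps He) as [d [dp H]].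
exists d. split; [exact dp|]. intros y yd. apply H; [now apply clamp_in|].
assert (L := clamp_lipschitz a b y e). lra.
Qed.

Lemma continuous_on_interval_of_clamped f a b : continuity (fun x => f (clamp a b x)) ->
  continuous_on_interval f a b.
Proof.
intros cf x xr eps He. destruct (continuity_eps _ cf x eps He) as [d [dp H]].
exists d. split; [exact dp|]. intros y yr yd. specialize (H y yd). cbv beta in H.
now rewrite !clamp_id in H.
Qed.

Lemma fiter_clamped f a b i x : maps_into f a b -> a <= x <= b ->
  fiter i (fun z => f (clamp a b z)) x = fiter i f x.
Proof.
intros fin xr.
assert (K : fiter i (fun z => f (clamp a b z)) x = fiter i f x /\ a <= fiter i f x <= b).
{ induction i as [|i [IH1 IH2]]; [now split|]. simpl. rewrite IH1, clamp_id by exact IH2.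
  split; [reflexivity | now apply fin]. }
apply K.
Qed.

Lemma min_period_clamped f a b m x : maps_into f a b -> a <= x <= b ->
  min_period (fun z => f (clamp a b z)) m x <-> min_period f m x.
Proof.
intros fin xr. unfold min_period.
assert (E := fun i => fiter_clamped f a b i x fin xr).
split; intros [m1 [mx H]]; (split; [exact m1|]); (split; [now rewrite E in * || rewrite <- E|]);
  intros j jm; specialize (H j jm); now rewrite E in *.
Qed.

(** A periodic point is a value of the clamped map. *)
Lemma periodic_clamped_in f a b m x : a <= b -> maps_into f a b ->
  min_period (fun z => f (clamp a b z)) m x -> a <= x <= b.
Proof.
intros ab fin [m1 [mx _]]. rewrite <- mx. destruct m as [|m]; [lia|].
simpl. apply fin, clamp_in, ab.
Qed.

Lemma length_ratio (L : list R) t z : (1 <= t)%nat -> Z.of_nat (length L * t) = z ->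
  INR (length L) = IZR z / INR t.
Proof.
intros t1 <-. assert (0 < INR t) by (apply lt_0_INR; lia).
rewrite <- INR_IZR_INZ, mult_INR. field. lra.
Qed.

Theorem theorem3 (n k : nat) (hn : (1 <= n)%nat) :
  let s := (2 ^ k * (2 * n + 1))%nat in
  (forall (a b : R) (f : R -> R),
     a <= b ->
     continuous_on_interval f a b ->
     maps_into f a b ->
     has_orbit_of_period f a b s ->
     (forall r : nat, sh_prec r s -> ~ has_orbit_of_period f a b r) ->
     forall t : nat, (0 < t)%nat -> sh_prec s t -> Nat.divide (2 ^ k) t ->
       exists L : list R, distinct_orbits f a b t L /\
         INR (length L) >= IZR (Phi n (t / 2 ^ k)) / INR (t / 2 ^ k))
  /\
  (exists (a b : R) (f : R -> R),
     a <= b /\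
     continuous_on_interval f a b /\
     maps_into f a b /\
     has_orbit_of_period f a b s /\
     (forall r : nat, sh_prec r s -> ~ has_orbit_of_period f a b r) /\
     forall t : nat, (0 < t)%nat -> sh_prec s t -> Nat.divide (2 ^ k) t ->
       exists L : list R, distinct_orbits f a b t L /\ covers_orbits f a b t L /\
         INR (length L) = IZR (Phi n (t / 2 ^ k)) / INR (t / 2 ^ k)).
Proof.
intro s. assert (pk : (2 ^ k <> 0)%nat) by (apply Nat.pow_nonzero; lia).
split.
- intros a b f ab cf fin [x0 [x0r x0P]] no t t0 st [q ->].
  rewrite Nat.div_mul by exact pk. assert (q1 : (1 <= q)%nat) by nia.
  rewrite Nat.mul_comm in st |- *.
  set (F := fun z => f (clamp a b z)).
  destruct (forced_orbits n k hn F (continuity_clamped f a b ab cf)) with (t := q)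
    as [L [[L1 L2] L3]]; trivial.
  + exists x0. now apply min_period_clamped.
  + intros r x rs rx. apply (no r rs). exists x.
    assert (xr := periodic_clamped_in f a b r x ab fin rx). split; [exact xr|].
    now apply (min_period_clamped f a b).
  + assert (L1' : forall x, In x L -> a <= x <= b /\ min_period f (2 ^ k * q) x).
    { intros x xL. assert (xr := periodic_clamped_in f a b _ x ab fin (L1 x xL)).
      split; [exact xr|]. now apply (min_period_clamped f a b), L1. }
    exists L. split; [split; [exact L1'|]|].
    * intros i j il jl ij [d dE]. apply (L2 i j il jl ij). exists d.
      unfold F. rewrite fiter_clamped; trivial. apply L1'. now apply nth_In.
    * right. now apply length_ratio.
- destruct (sharp_example n k hn) as [a [b [f [ab [cf [fin [ex [no tt]]]]]]]].
  exists a, b, f. split; [lra|]. split; [now apply continuous_on_interval_of_clamped|].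
  split; [exact fin|]. split; [exact ex|]. split; [exact no|].
  intros t t0 st [q ->]. rewrite Nat.div_mul by exact pk. assert (q1 : (1 <= q)%nat) by nia.
  rewrite Nat.mul_comm in st |- *.
  destruct (tt q q1 st) as [L [L1 [[L2 L3] [L4 L5]]]].
  exists L. split; [split|split].
  + intros x xL. split; [now apply L1 | now apply L2].
  + exact L3.
  + exact L4.
  + now apply length_ratio.
Qed.
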